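(* Let $K$ be a convex body in $\mathbb{R}^d$ and let $T:\mathbb{R}^d\to\mathbb{R}^d$ be a linear contraction. Then $V_i(T[K])\le V_i(K)$ for $i=0,\dots,d$.
   Context: A linear contraction is a linear map that is $1$-Lipschitz for the Euclidean norm. $V_i$ denotes the $i$-th intrinsic volume, defined for nonempty compact convex sets $L\subset\mathbb{R}^d$ by Steiner's formula $\mathrm{Vol}(L+rB)=\sum_{i=0}^d r^{d-i}\kappa_{d-i}V_i(L)$ for all $r\ge0$, where $B$ is the closed Euclidean unit ball of $\mathbb{R}^d$ and $\kappa_j$ is the volume of the unit ball in $\mathbb{R}^j$ ($\kappa_0=1$). *)

(* Defs.v *)
From HB Require Import structures.
From mathcomp Require Import all_boot all_order all_algebra.
From mathcomp Require Import all_classical all_reals all_analysis.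

Set Implicit Arguments.
Unset Strict Implicit.
Unset Printing Implicit Defensive.

Import Order.TTheory GRing.Theory Num.Theory.
Import numFieldTopology.Exports numFieldNormedType.Exports.

Local Open Scope classical_set_scope.
Local Open Scope ring_scope.

(* MathComp-Analysis has no Lebesgue measure on R^n.  We build it on n-tuples,
   with their library (product) sigma-algebra, by iterating the product measure
   along the bijection R * R^n -> R^(n+1). *)
Section lebesgue_tuple.
Variable R : realType.
Local Notation mR := (measurableTypeR R).

Definition tuple_cons n (p : mR * n.-tuple mR) : n.+1.-tuple mR :=
  [tuple of p.1 :: p.2].

Definition tuple_uncons n (t : n.+1.-tuple mR) : mR * n.-tuple mR :=
  (thead t, [tuple of behead t]).

Lemma tuple_consK n : cancel (@tuple_cons n) (@tuple_uncons n).
Proof.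
by move=> [x t]; congr pair; exact: val_inj.
Qed.

Lemma measurable_tuple_cons n : measurable_fun setT (@tuple_cons n).
Proof. exact: measurable_cons. Qed.

Lemma measurable_tuple_uncons n : measurable_fun setT (@tuple_uncons n).
Proof.
apply/measurable_fun_pairP; split; first exact: measurable_tnth.
exact: measurable_behead.
Qed.

Section step.
Variables (n : nat) (m : {sigma_finite_measure set (n.-tuple mR) -> \bar R}).

Definition cons_measure : set (n.+1.-tuple mR) -> \bar R :=
  pushforward (lebesgue_measure \x m)%E (@tuple_cons n).

(* The library's instance on [pushforward] takes the measurability proof as an
   argument, so it cannot be inferred and is named explicitly. *)
Let pushm := measure_function_pushforward__canonical__measure_function_Measure
  (lebesgue_measure \x m)%E (measurable_tuple_cons (n := n)).

HB.instance Definition _ := Measure.copy cons_measure pushm.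

Let cons_measure_sigma_finite : sigma_finite setT cons_measure.
Proof.
have /sigma_finiteP[F [TF ndF Foo]] :
  sigma_finite setT (lebesgue_measure : set mR -> \bar R) by exact: sigma_finiteT.
have /sigma_finiteP[G [TG ndG Goo]] := sigma_finiteT m.
exists (fun k => @tuple_uncons n @^-1` (F k `*` G k)).
  rewrite -preimage_bigcup (_ : \bigcup_k _ = setT) ?preimage_setT//.
  rewrite -setXTT TF TG predeqE => -[x y]; split => [[k _ []/= ? ?]|].
    by split; exists k.
  move=> [/= [k _ Fkx] [l _ Gly]]; exists (maxn k l) => //; split.
  - by move: x Fkx; exact/subsetPset/ndF/leq_maxl.
  - by move: y Gly; exact/subsetPset/ndG/leq_maxr.
move=> k; have [mF Fk] := Foo k; have [mG Gk] := Goo k; split.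
  rewrite -[X in measurable X]setTI; apply: measurable_tuple_uncons => //.
  exact: measurableX.
rewrite /cons_measure /pushforward -comp_preimage.
rewrite (_ : _ \o _ = id) ?preimage_id; last first.
  by apply/funext => p /=; rewrite tuple_consK.
by rewrite product_measure1E// lte_mul_pinfty// ge0_fin_numE.
Qed.

HB.instance Definition _ :=
  Measure_isSigmaFinite.Build _ _ _ cons_measure cons_measure_sigma_finite.

End step.

Fixpoint lebesgue_tuple n : {sigma_finite_measure set (n.-tuple mR) -> \bar R} :=
  if n is n'.+1 then cons_measure (lebesgue_tuple n')
  else dirac ([tuple] : 0.-tuple mR).

(* This characterizes [lebesgue_tuple] among measures: it is the n-dimensional
   Lebesgue measure. *)
Lemma lebesgue_tuple_box n (A : 'I_n -> set mR) :
  (forall i, measurable (A i)) ->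
  (lebesgue_tuple n [set t | forall i, A i (tnth t i)] =
   \prod_(i < n) lebesgue_measure (A i))%E.
Proof.
elim: n A => [|n IHn] A mA.
  by rewrite big_ord0 /= diracE mem_set// => -[].
have mB : measurable [set t : n.-tuple mR | forall i, A (lift ord0 i) (tnth t i)].
  rewrite (_ : [set _ | _] =
      \bigcap_(i in [set: 'I_n]) ((@tnth n mR)^~ i @^-1` A (lift ord0 i))).
    apply: fin_bigcap_measurable => // i _.
    by rewrite -[X in measurable X]setTI; exact: measurable_tnth.
  by apply/seteqP; split => t /= h i; [move=> _; exact: h|exact: (h i I)].
rewrite big_ord_recl -IHn//= /cons_measure /pushforward.
rewrite -product_measure1E//; congr product_measure1.
apply/seteqP; split => -[x t] /= h.
  by split; [exact: (h ord0)|move=> i; have := h (lift ord0 i); rewrite tnthS].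
move=> i; case: (unliftP ord0 i) => [j ->|->]; last exact: h.1.
by rewrite tnthS; exact: h.2.
Qed.

End lebesgue_tuple.

Section convex_geometry.
Variable R : realType.

Definition vol d (A : set 'rV[R]_d) : \bar R :=
  lebesgue_tuple R d [set t | A (\row_i tnth t i)].

(* The library norm on 'rV[R]_d is the sup norm. *)
Definition enorm d (x : 'rV[R]_d) : R := Num.sqrt (\sum_i x 0 i ^+ 2).

Definition unit_ball d : set 'rV[R]_d := [set x | enorm x <= 1].

Definition kappa j : R := fine (vol (@unit_ball j)).

Definition parallel_body d (L : set 'rV[R]_d) (r : R) : set 'rV[R]_d :=
  [set x + r *: b | x in L & b in @unit_ball d].

(* The topology of 'rV[R]_d is the usual one: the library's sup norm is
   equivalent to [enorm]. *)
Definition convex_body d (K : set 'rV[R]_d) : Prop :=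
  [/\ K !=set0, compact K & convex_set K].

Definition steiner_formula d (L : set 'rV[R]_d) (V : 'I_d.+1 -> R) : Prop :=
  forall r, 0 <= r ->
  vol (parallel_body L r) = (\sum_(i < d.+1) r ^+ (d - i) * kappa (d - i) * V i)%:E.

(* Junk value when no family satisfies Steiner's formula, which does not happen
   for a convex body. *)
Definition intrinsic_volume d (L : set 'rV[R]_d) : 'I_d.+1 -> R :=
  get (@steiner_formula d L).

Definition euclidean_contraction d (T : 'rV[R]_d -> 'rV[R]_d) : Prop :=
  forall x y, enorm (T x - T y) <= enorm (x - y).

End convex_geometry.

(* Main.v *)
(* The volume of K + s [0, w] is affine in s, because lengthening a convex body
   in direction w adds translates of one and the same set.  Hence, for a zonotope
   Z = sum_j [0, w_j], the volume of K + r Z is a polynomial in r, whose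
   coefficients are sums of iterated differences D_w phi (K) =
   phi(K + [0, w]) - phi(K); such differences are monotone in K, and
   D_w phi is subadditive in w.
   The unit ball is squeezed between zonotopes Z and (1 + e) Z (averaging the
   support function of a zonotope over finitely many rotations flattens it), so
   the limit gives Steiner's formula, the coefficients being limits of those of
   Vol(K + r Z).
   For L in R * R^d, the body p_y(L) = {z - h y | (h, z) in L} satisfies
   Vol_d(p_y(L)) = D_(1, y) Vol_(d+1) (L), so every coefficient for p_y(L) is
   D_(1, y) of a monotone functional of L and thus convex in y.  Consequently
   s |-> V_i((T + s v^T u) K) is convex.
   Finally, if the matrix 1 - T T^T is not 0, it has a nonzero row v at some
   pivot a > 0, and for a suitable u there are s1 < 0 < s2 such that
   1 - T_s T_s^T = (1 - T T^T) - v^T v / a for T_s = T + s v^T u, s = s1, s2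
   (row vectors, T acting on the right).  Both T_s are contractions with fewer
   nonzero rows in 1 - T_s T_s^T, and V_i(T K) is at most the larger of the two
   V_i(T_s K).  By induction the claim reduces to orthogonal T. *)

From HB Require Import structures.
Require Import Defs.
From mathcomp Require Import all_boot all_order all_algebra.
From mathcomp Require Import all_classical all_reals all_analysis.
From mathcomp Require Import measurable_realfun.
From mathcomp Require Import ring lra.

Set Implicit Arguments.
Unset Strict Implicit.
Unset Printing Implicit Defensive.

Import Order.TTheory GRing.Theory Num.Theory.
Import numFieldTopology.Exports numFieldNormedType.Exports.

Local Open Scope classical_set_scope.
Local Open Scope ring_scope.

(** * Lebesgue measure on row vectors *)

Section volume.
Variable R : realType.
Local Notation mR := (measurableTypeR R).
Local Notation mu := (@lebesgue_measure R).

Definition row_of n (t : n.-tuple mR) : 'rV[R]_n := \row_i tnth t i.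
Definition tuple_of n (x : 'rV[R]_n) : n.-tuple mR := [tuple x 0 i | i < n].

Lemma tuple_ofK n : cancel (@tuple_of n) (@row_of n).
Proof. by move=> x; apply/rowP => i; rewrite mxE tnth_mktuple. Qed.

(** Since [vol] is computed on tuples, measurability is that of the product sigma-algebra there. *)
Definition vmeasurable n (A : set 'rV[R]_n) := measurable (@row_of n @^-1` A).

Lemma vol_set0 n : vol (set0 : set 'rV[R]_n) = 0%E.
Proof. by rewrite /vol (_ : [set t | _] = set0) ?measure0. Qed.

Lemma vol_ge0 n (A : set 'rV[R]_n) : (0 <= vol A)%E.
Proof. exact: measure_ge0. Qed.

Lemma le_vol n (A B : set 'rV[R]_n) :
  vmeasurable A -> vmeasurable B -> A `<=` B -> (vol A <= vol B)%E.
Proof.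
move=> mA mB AB; apply: le_measure; rewrite ?inE//.
by move=> t; exact: AB.
Qed.

Lemma vol_setD n (A B : set 'rV[R]_n) :
  vmeasurable A -> vmeasurable B -> A `<=` B -> (vol B < +oo)%E ->
  vol (B `\` A) = (vol B - vol A)%E.
Proof.
move=> mA mB AB Bfin.
have AB' : @row_of n @^-1` A `<=` @row_of n @^-1` B by move=> t; exact: AB.
by have := measureD mB mA Bfin; rewrite (setIidr AB').
Qed.

Definition slice n (A : set 'rV[R]_(1 + n)) (x : R) : set 'rV[R]_n :=
  [set y | A (row_mx x%:M y)].

Lemma row_of_cons n (x : mR) (t : n.-tuple mR) :
  row_of (tuple_cons (x, t)) = row_mx x%:M (row_of t) :> 'rV_(1 + n).
Proof.
apply/rowP => i; case: (@split_ordP 1 n i) => j ->.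
  by rewrite row_mxEl !mxE !ord1.
rewrite row_mxEr !mxE (_ : rshift 1 j = lift ord0 j) ?tnthS//.
exact: val_inj.
Qed.

Lemma xsection_slice n (A : set 'rV[R]_(1 + n)) x :
  xsection (@tuple_cons R n @^-1` (@row_of n.+1 @^-1` A)) x =
  @row_of n @^-1` slice A x.
Proof.
apply/predeqP => t; split => [/set_mem h|h]; last apply: mem_set.
  by rewrite /preimage /slice /mkset -row_of_cons.
by move: h; rewrite /preimage /slice /mkset -row_of_cons.
Qed.

(** Holds by unfolding: in dimension [n + 1] the measure is the pushforward of a product measure,
    whose value is by definition the integral of the measures of the sections. *)
Lemma vol_slice n (A : set 'rV[R]_(1 + n)) :
  vol A = (\int[mu]_x vol (slice A x))%E.
Proof.
apply: eq_integral => x _; rewrite /vol -[X in _ = _ X]xsection_slice.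
exact.
Qed.

Lemma vmeasurable_slice n (A : set 'rV[R]_(1 + n)) x :
  vmeasurable A -> vmeasurable (slice A x).
Proof.
move=> mA; rewrite /vmeasurable -xsection_slice; apply: measurable_xsection.
by rewrite -[X in measurable X]setTI; exact: measurable_tuple_cons.
Qed.

Lemma measurable_fun_slice n (A : set 'rV[R]_(1 + n)) :
  vmeasurable A -> measurable_fun [set: mR] (fun x => vol (slice A x) : \bar R).
Proof.
move=> mA.
have mB : measurable (@tuple_cons R n @^-1` (@row_of n.+1 @^-1` A)).
  by rewrite -[X in measurable X]setTI; exact: measurable_tuple_cons.
have := measurable_fun_xsection (lebesgue_tuple R n) mB.
by apply: eq_measurable_fun => x _; rewrite /= xsection_slice.
Qed.

(** The shifted measure has the right value on half-open intervals, which determine Lebesgue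
    measure. *)
Lemma lebesgue_measure_shift (v : R) (A : set mR) : measurable A ->
  pushforward mu (fun x : mR => x + v : mR) A = mu A.
Proof.
have mshift : measurable_fun [set: mR] (fun x : mR => x + v : mR).
  exact: measurable_funD.
pose pushm := measure_function_pushforward__canonical__measure_function_Measure
  mu mshift.
move=> mA; apply/esym.
apply: (@lebesgue_measure_unique R pushm _ A mA) => //= _ [[a b]] _ <-.
rewrite /pushforward (_ : _ @^-1` _ = `]a - v, b - v]%classic).
  by rewrite !lebesgue_measure_itv/= !lte_fin ltrD2r -!EFinB opprB addrA addrNK.
by apply/seteqP; split => x /=; rewrite !in_itv/= ltrBlDr lerBrDr.
Qed.

Lemma measurable_affine n m (M : 'M[R]_(n, m)) (v : 'rV[R]_m) :
  measurable_fun setT (fun t : n.-tuple mR => tuple_of (row_of t *m M + v)).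
Proof.
apply/measurable_fun_tnthP => i /=.
rewrite (_ : _ \o _ = fun t => \sum_j (tnth t j * M j i) + v 0 i); last first.
  apply/funext => t /=; rewrite tnth_mktuple !mxE; congr (_ + _).
  by apply: eq_bigr => j _; rewrite mxE.
apply: measurable_funD => //; apply: measurable_sum => j.
by apply: measurable_funM => //; exact: measurable_tnth.
Qed.

Lemma vmeasurable_affine n m (M : 'M[R]_(n, m)) (v : 'rV[R]_m) A :
  vmeasurable A -> vmeasurable [set x | A (x *m M + v)].
Proof.
move=> mA; rewrite /vmeasurable.
have -> : @row_of n @^-1` [set x | A (x *m M + v)] =
   (fun t => tuple_of (row_of t *m M + v)) @^-1` (@row_of m @^-1` A).
  by apply/seteqP; split => t /=; rewrite tuple_ofK.
by rewrite -[X in measurable X]setTI; exact: measurable_affine.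
Qed.

Lemma vmeasurable_shift n (v : 'rV[R]_n) A :
  vmeasurable A -> vmeasurable [set x | A (x + v)].
Proof.
by move/(vmeasurable_affine 1%:M v); under eq_set do rewrite mulmx1.
Qed.

(** Induction on the dimension: the slices are shifted by the tail of [v], and the slicing variable
    by its first coordinate. *)
Lemma vol_shift n (v : 'rV[R]_n) A : vmeasurable A ->
  vol [set x | A (x + v)] = vol A.
Proof.
elim: n v A => [|n IHn] v A mA.
  congr vol; apply/funext => x; congr A.
  by rewrite [RHS]thinmx0 [LHS]thinmx0.
pose v0 := @lsubmx R 1 1 n v; pose v' := @rsubmx R 1 1 n v.
have vE : v = row_mx v0 v' by rewrite hsubmxK.
rewrite -[n.+1]/(1 + n)%N in v A mA v0 v' vE *.
rewrite !vol_slice.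
transitivity (\int[mu]_x vol (slice A (x + v0 0 0)%R))%E.
  apply: eq_integral => x _; rewrite -[RHS](IHn v');
    last exact: vmeasurable_slice.
  congr vol; apply/funext => y; rewrite /slice/= vE add_row_mx.
  by rewrite {1}(mx11_scalar v0) -raddfD.
have mshift : measurable_fun [set: mR] (fun x : mR => x + v0 0 0 : mR).
  exact: measurable_funD.
have h := @ge0_integral_pushforward _ _ _ _ R (fun x : mR => x + v0 0 0 : mR)
  mshift mu setT (fun x => vol (slice A x)).
rewrite preimage_setT in h; rewrite -{}h //.
- apply: eq_measure_integral => B mB _; exact: lebesgue_measure_shift.
- exact: measurable_fun_slice.
Qed.

End volume.

(** * Linear images and measurability *)

Section linear_change.
Variable R : realType.
Local Notation mR := (measurableTypeR R).
Local Notation mu := (@lebesgue_measure R).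
Local Notation lam n := (lebesgue_tuple R n).

(** Covers the Fubini integrals below, where the sections have one common volume over a set and are
    null elsewhere. *)
Lemma integral_two_valued d (T : measurableType d)
    (m : {measure set T -> \bar R}) (B : set T) (c : \bar R) (f : T -> \bar R) :
  measurable B -> (0 <= c)%E ->
  (forall x, B x -> f x = c) -> (forall x, ~ B x -> f x = 0%E) ->
  (\int[m]_x f x = m B * c)%E.
Proof.
move=> mB c0 fB fNB.
rewrite (eq_integral (fun x => (\1_B x)%:E * c)%E); last first.
  move=> x _; rewrite indicE;
    have [/set_mem /fB ->|/negP xB] := boolP (x \in B).
    by rewrite mul1e.
  by rewrite mul0e fNB// => /mem_set.
rewrite ge0_integralZr ?integral_indic ?setIT//; exact: measurableT_comp.
Qed.

(* Fubini on [{(x, y) | x M in A, x M + y in E}], read in both orders. *)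
Lemma vol_linear_swap n (M : 'M[R]_n) (A E : set 'rV[R]_n) :
  M \in unitmx -> vmeasurable A -> vmeasurable E ->
  (vol [set x | A (x *m M)] * vol E =
   vol [set x | E (x *m M)] * vol [set y | A (- y)%R])%E.
Proof.
move=> uM mA mE.
pose f1 (p : n.-tuple mR * n.-tuple mR) : n.-tuple mR :=
  tuple_of (row_of p.1 *m M + 0).
pose f2 (p : n.-tuple mR * n.-tuple mR) : n.-tuple mR :=
  tuple_of (row_of p.1 *m M + row_of p.2).
pose f3 (p : n.-tuple mR * n.-tuple mR) : n.-tuple mR :=
  tuple_of (row_of p.1 *m M - row_of p.2).
have mf1 : measurable_fun setT f1.
  exact: (measurableT_comp (measurable_affine M 0)).
have mfe (e : R) : measurable_fun setT
    (fun p : n.-tuple mR * n.-tuple mR =>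
      tuple_of (row_of p.1 *m M + e *: row_of p.2) : n.-tuple mR).
  apply/measurable_fun_tnthP => i.
  have /measurable_fun_tnthP /(_ i) m1 := mf1.
  rewrite (_ : _ \o _ =
    fun p => tnth (f1 p) i + e * tnth p.2 i :> mR); last first.
    by apply/funext => p /=; rewrite !tnth_mktuple !mxE addr0.
  apply: measurable_funD; first exact: m1.
  apply: measurable_funM; first exact: measurable_cst.
  exact: (measurableT_comp (measurable_tnth i) measurable_snd).
have mf2 : measurable_fun setT f2.
  by have := mfe 1; under eq_fun do rewrite scale1r.
have mf3 : measurable_fun setT f3.
  by have := mfe (-1); under eq_fun do rewrite scaleN1r.
pose S := (f1 @^-1` (@row_of R n @^-1` A)) `&` (f2 @^-1` (@row_of R n @^-1` E)).
pose S' := (f3 @^-1` (@row_of R n @^-1` A)) `&` (f1 @^-1` (@row_of R n @^-1`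
  E)).
have pre (f : n.-tuple mR * n.-tuple mR -> n.-tuple mR) B :
    measurable_fun setT f -> measurable B -> measurable (f @^-1` B).
  by move=> mf mB; rewrite -[X in measurable X]setTI; exact: mf.
have mS : measurable S by apply: measurableI; exact: pre.
have mS' : measurable S' by apply: measurableI; exact: pre.
have swap B : measurable B -> (lam n \x lam n)%E B = (lam n \x^ lam n)%E B.
  exact: product_measure_unique (product_measure2E (lam n) (lam n)) _.
have sec1 : (lam n \x lam n)%E S = (vol [set x | A (x *m M)] * vol E)%E.
  apply: integral_two_valued => //.
  - have := vmeasurable_affine M 0 mA.
    by under eq_set do rewrite addr0.
  - move=> x /= Ax; rewrite -[RHS](vol_shift (row_of x *m M) mE).
    congr (lam n _); apply/predeqP => t; split.
      move=> /set_mem[_]; rewrite /f2 /preimage /= tuple_ofK addrC; exact.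
    move=> Et; apply: mem_set; split;
      rewrite /f1 /f2 /preimage /= tuple_ofK ?addr0//.
    by rewrite addrC.
  - move=> x /= NAx; rewrite (_ : xsection _ _ = set0) ?measure0//.
    apply/predeqP => t; split => // /set_mem[].
    by rewrite /f1 /preimage /= tuple_ofK addr0 => /NAx.
have sec2 : (lam n \x lam n)%E S' = (vol [set x | E (x *m M)] * vol [set y | A
  (- y)%R])%E.
  have mA' : vmeasurable [set y | A (- y)%R].
    have := vmeasurable_affine (-1)%:M 0 mA.
    by under eq_set do rewrite addr0 mul_mx_scalar scaleN1r.
  apply: integral_two_valued => //.
  - have := vmeasurable_affine M 0 mE.
    by under eq_set do rewrite addr0.
  - move=> x /= Ax; rewrite -[RHS](vol_shift (- (row_of x *m M)) mA').
    congr (lam n _); apply/predeqP => t; split.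
      by move=> /set_mem[]; rewrite /f3 /preimage /= !tuple_ofK opprB.
    move=> Et; apply: mem_set; split;
      rewrite /f1 /f3 /preimage /= tuple_ofK ?addr0//.
    by move: Et => /=; rewrite opprB.
  - move=> x /= NAx; rewrite (_ : xsection _ _ = set0) ?measure0//.
    apply/predeqP => t; split => // /set_mem[].
    by rewrite /f1 /preimage /= !tuple_ofK addr0 => _ /NAx.
rewrite -sec1 -sec2; suff sSS' : (lam n \x^ lam n)%E S = (lam n \x^ lam n)%E S'.
  by move: (swap _ mS) (swap _ mS'); rewrite sSS' => -> ->.
(* For fixed [y], the sections of [S] and [S'] are translates of each other by [y *m invmx M]. *)
apply: eq_integral => y _ /=.
pose A' : set 'rV[R]_n := [set x | A (x *m M) /\ E (x *m M + row_of y)].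
have mA' : vmeasurable A'.
  apply: measurableI; last exact: vmeasurable_affine.
  by have := vmeasurable_affine M 0 mA; under eq_set do rewrite addr0.
transitivity (vol A').
  congr (lam n _); apply/predeqP => t; split.
    by move=> /set_mem[]; rewrite /f1 /f2 /preimage /= !tuple_ofK addr0.
  by move=> ?; apply: mem_set;
    rewrite /S /f1 /f2 /preimage /setI/= !tuple_ofK addr0.
rewrite -(vol_shift (- (row_of y *m invmx M)) mA').
congr (lam n _); apply/predeqP => t; split.
  rewrite /A' /= mulmxDl mulNmx -mulmxA mulVmx// mulmx1 addrNK => ?.
  by apply: mem_set; rewrite /S' /f1 /f3 /preimage /setI/= !tuple_ofK addr0.
move=> /set_mem[]; rewrite /f1 /f3 /preimage /= !tuple_ofK addr0.
by rewrite /A' /= mulmxDl mulNmx -mulmxA mulVmx// mulmx1 addrNK.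
Qed.

(** An open set is the countable union of the sup-norm balls it contains with rational centre and
    radius [1 / (k + 1)], and such balls are boxes. *)
Lemma open_vmeasurable n (U : set 'rV[R]_n) : open U -> vmeasurable U.
Proof.
move=> oU.
pose q2r (q : 'rV[rat]_n) : 'rV[R]_n := map_mx ratr q.
pose I : set ('rV[rat]_n * nat) :=
  [set p | ball (q2r p.1) (p.2.+1%:R^-1) `<=` U].
have UE : U = \bigcup_(p in I) ball (q2r p.1) (p.2.+1%:R^-1).
  apply/predeqP => x; split=> [Ux|[p Ip]]; last exact: Ip.
  have /nbhs_ballP[e /= e0 eU] := open_nbhs_nbhs (conj oU Ux).
  have [k ke] : exists k, k.+1%:R^-1 < e / 2.
    have e2 : 0 < e / 2 by rewrite divr_gt0.
    by have [k] := ltr_add_invr e2; rewrite add0r => ?; exists k.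
  have hq i : exists q : rat, `|ratr q - x 0 i| < k.+1%:R^-1.
    have lt_itv : x 0 i - k.+1%:R^-1 < x 0 i + k.+1%:R^-1.
      by rewrite ltrD2l gtrN ?invr_gt0.
    have [q] := rat_in_itvoo lt_itv.
    by rewrite in_itv/= => /andP[? ?]; exists q; rewrite ltr_distl; apply/andP.
  pose q : 'rV[rat]_n := \row_i projT1 (cid (hq i)).
  have xq : ball (q2r q) k.+1%:R^-1 x.
    split; first by rewrite invr_gt0.
    move=> i j; rewrite ord1 !mxE /ball/= /ball_.
    by case: cid => /=.
  exists (q, k) => //= z qz; apply: eU.
  rewrite (splitr e).
  apply: (ball_triangle (y := q2r q)).
    by apply: ball_sym; apply: le_ball xq; exact: ltW.
  by apply: le_ball qz; exact: ltW.
rewrite /vmeasurable UE preimage_bigcup bigcup_mkcond.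
apply: countable_bigcupT_measurable => [|p]; first exact: countableP.
case: ifP => // _.
have mB : measurable (\bigcap_(i in [set: 'I_n])
    ((@tnth n mR)^~ i @^-1` [set y | `|q2r p.1 0 i - y| < p.2.+1%:R^-1])).
  apply: fin_bigcap_measurable => // i _.
  rewrite -[X in measurable X]setTI; apply: measurable_tnth => //.
  apply: open_measurable.
  rewrite (_ : [set _ | _] = ball (q2r p.1 0 i) p.2.+1%:R^-1)//.
  exact: ball_open.
congr measurable : mB; apply/predeqP => t; split.
  move=> h; split; first by rewrite invr_gt0.
  by move=> i j; rewrite !ord1 [row_of t _ _]mxE; exact: h.
by move=> [_ h] i _; have := h 0 i; rewrite [row_of t _ _]mxE.
Qed.

Lemma closed_vmeasurable n (F : set 'rV[R]_n) : closed F -> vmeasurable F.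
Proof.
move=> /closed_openC /open_vmeasurable mF.
by rewrite -[F]setCK /vmeasurable preimage_setC; exact: measurableC.
Qed.

End linear_change.

(** * Euclidean geometry *)

Section euclid.
Variable R : realType.
Implicit Types n m : nat.

Definition dot n (x y : 'rV[R]_n) : R := \sum_i x 0 i * y 0 i.

Lemma dotE n (x y : 'rV[R]_n) : dot x y = (x *m y^T) 0 0.
Proof. by rewrite mxE; apply: eq_bigr => i _; rewrite mxE. Qed.

Lemma dotC n (x y : 'rV[R]_n) : dot x y = dot y x.
Proof. by apply: eq_bigr => i _; rewrite mulrC. Qed.

Lemma dotDl n (x y z : 'rV[R]_n) : dot (x + y) z = dot x z + dot y z.
Proof. by rewrite !dotE mulmxDl mxE. Qed.

Lemma dotDr n (x y z : 'rV[R]_n) : dot z (x + y) = dot z x + dot z y.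
Proof. by rewrite dotC dotDl !(dotC z). Qed.

Lemma dotZl n a (x y : 'rV[R]_n) : dot (a *: x) y = a * dot x y.
Proof. by rewrite !dotE -scalemxAl mxE. Qed.

Lemma dotZr n a (x y : 'rV[R]_n) : dot x (a *: y) = a * dot x y.
Proof. by rewrite dotC dotZl dotC. Qed.

Lemma dotNl n (x y : 'rV[R]_n) : dot (- x) y = - dot x y.
Proof. by rewrite -scaleN1r dotZl mulN1r. Qed.

Lemma dotNr n (x y : 'rV[R]_n) : dot x (- y) = - dot x y.
Proof. by rewrite dotC dotNl dotC. Qed.

Lemma dot0l n (x : 'rV[R]_n) : dot 0 x = 0.
Proof. by rewrite dotE mul0mx mxE. Qed.

Lemma dot0r n (x : 'rV[R]_n) : dot x 0 = 0.
Proof. by rewrite dotC dot0l. Qed.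

Lemma dot_mull n m (x : 'rV[R]_n) (M : 'M[R]_(n, m)) (y : 'rV[R]_m) :
  dot (x *m M) y = dot x (y *m M^T).
Proof. by rewrite !dotE trmx_mul trmxK mulmxA. Qed.

Lemma dot_delta n (x : 'rV[R]_n) j : dot x (delta_mx 0 j) = x 0 j.
Proof.
rewrite /dot (bigD1 j)//= big1 => [|l lj];
  first by rewrite mxE !eqxx mulr1 addr0.
by rewrite mxE (negPf lj) andbF mulr0.
Qed.

Lemma dot_ge0 n (x : 'rV[R]_n) : 0 <= dot x x.
Proof. by apply: sumr_ge0 => i _; rewrite -expr2 sqr_ge0. Qed.

Lemma dot_eq0 n (x : 'rV[R]_n) : dot x x = 0 -> x = 0.
Proof.
move=> /eqP; rewrite psumr_eq0 => [/allP h|i _]; last by rewrite -expr2 sqr_ge0.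
apply/rowP => i; rewrite mxE.
by have /implyP/(_ isT) := h i (mem_index_enum i);
  rewrite -expr2 sqrf_eq0 => /eqP.
Qed.

Lemma enormE n (x : 'rV[R]_n) : enorm x = Num.sqrt (dot x x).
Proof. by congr Num.sqrt; apply: eq_bigr => i _; rewrite expr2. Qed.

Lemma enorm_ge0 n (x : 'rV[R]_n) : 0 <= enorm x.
Proof. exact: sqrtr_ge0. Qed.

Lemma sqr_enorm n (x : 'rV[R]_n) : enorm x ^+ 2 = dot x x.
Proof. by rewrite enormE sqr_sqrtr// dot_ge0. Qed.

Lemma enorm_gt0 n (x : 'rV[R]_n) : x != 0 -> 0 < enorm x.
Proof.
move=> /eqP x0; rewrite lt_neqAle enorm_ge0 andbT; apply/eqP => e0; apply: x0.
by apply: dot_eq0; rewrite -sqr_enorm -e0 expr0n.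
Qed.

Lemma enorm0 n : enorm (0 : 'rV[R]_n) = 0.
Proof. by rewrite enormE dot0l sqrtr0. Qed.

Lemma enormZ n a (x : 'rV[R]_n) : enorm (a *: x) = `|a| * enorm x.
Proof.
by rewrite !enormE dotZl dotZr mulrA -expr2 sqrtrM ?sqr_ge0// sqrtr_sqr.
Qed.

Lemma enormN n (x : 'rV[R]_n) : enorm (- x) = enorm x.
Proof. by rewrite -scaleN1r enormZ normrN1 mul1r. Qed.

Lemma enorm_le n (x : 'rV[R]_n) a : 0 <= a ->
  (enorm x <= a) = (dot x x <= a ^+ 2).
Proof. by move=> a0; rewrite -sqr_enorm ler_pXn2r// nnegrE enorm_ge0. Qed.

(** Cauchy-Schwarz, by expanding the square of [enorm y *: x - enorm x *: y]. *)
Lemma dot_le n (x y : 'rV[R]_n) : dot x y <= enorm x * enorm y.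
Proof.
have [->|x0] := eqVneq x 0; first by rewrite dot0l enorm0 mul0r.
have [->|y0] := eqVneq y 0; first by rewrite dotC dot0l enorm0 mulr0.
have := dot_ge0 (enorm y *: x - enorm x *: y).
rewrite !(dotDl, dotDr, dotNl, dotNr, dotZl, dotZr) (dotC y x) -!sqr_enorm.
set a := enorm x; set b := enorm y; set c := dot x y => h.
have ab0 : 0 < a * b by rewrite mulr_gt0// enorm_gt0.
rewrite -(ler_pM2l ab0); nra.
Qed.

Lemma enormD n (x y : 'rV[R]_n) : enorm (x + y) <= enorm x + enorm y.
Proof.
rewrite enorm_le ?addr_ge0 ?enorm_ge0// !(dotDl, dotDr) (dotC y x) -!sqr_enorm.
by have := dot_le x y; nra.
Qed.

Lemma coord_le_enorm n (x : 'rV[R]_n) i : `|x 0 i| <= enorm x.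
Proof.
rewrite -sqrtr_sqr ler_wsqrtr// (bigD1 i)//= lerDl.
by apply: sumr_ge0 => j _; rewrite sqr_ge0.
Qed.

Lemma enorm_le_sum n (x : 'rV[R]_n) : enorm x <= \sum_i `|x 0 i|.
Proof.
rewrite enorm_le ?sumr_ge0// /dot expr2 mulr_suml ler_sum// => i _.
rewrite (le_trans (ler_norm _))// normrM ler_wpM2l// (bigD1 i)//= lerDl.
exact: sumr_ge0.
Qed.

Lemma enorm_coord_le n (x : 'rV[R]_n) a :
  (forall i, `|x 0 i| <= a) -> enorm x <= n%:R * a.
Proof.
move=> xa; rewrite (le_trans (enorm_le_sum x))// (le_trans (ler_sum _ (fun i _
  => xa i)))//.
by rewrite sumr_const card_ord mulr_natl.
Qed.

Lemma continuous_sum n (I : finType) (f : I -> 'rV[R]_n -> R) :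
  (forall i, continuous (f i)) -> continuous (fun x => \sum_i f i x).
Proof.
by move=> fc; apply: continuous_big => //; exact: add_continuous.
Qed.

Lemma enorm_continuous n : continuous (@enorm R n).
Proof.
have h : continuous (fun x : 'rV[R]_n => \sum_i x 0 i ^+ 2).
  apply: continuous_sum => i y.
  exact: continuousM (@coord_continuous R 1 n 0 i y)
    (@coord_continuous R 1 n 0 i y).
by move=> x; exact: continuous_comp (h x) (@sqrt_continuous R _).
Qed.

Definition cube n (c : R) : set 'rV[R]_n := [set x | forall i, `|x 0 i| <= c].

Lemma compact_cube n c : compact (@cube n c).
Proof.
have := @rV_compact R n (fun=> [set` `[- c, c]]) (fun=> @segment_compact R _ _).
by congr compact; apply/predeqP => x; split => h i; have := h i;
  rewrite /= in_itv/= ler_norml.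
Qed.

Lemma compact_sub_cube n (K : set 'rV[R]_n) :
  compact K -> exists2 c, 0 < c & K `<=` cube c.
Proof.
move=> /compact_bounded [M [_ hM]]; exists (`|M| + 1);
  first by rewrite ltr_wpDl.
move=> x Kx i.
have {}/hM : M < `|M| + 1 by rewrite (le_lt_trans (ler_norm _))// ltrDl.
move=> /(_ _ Kx); apply: le_trans.
rewrite [leRHS]/Num.norm/= mx_normrE.
by apply/bigmax_geP; right; exists (0, i).
Qed.

Lemma compact_unit_ball n : compact (@unit_ball R n).
Proof.
apply: (subclosed_compact _ (@compact_cube n 1)).
  apply: (@preimage_closed _ _ (@enorm R n) [set r | r <= 1]).
    by move=> x _; exact: enorm_continuous.
  exact: closed_le.
by move=> x x1 i; rewrite (le_trans (coord_le_enorm _ _)).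
Qed.

Lemma convexP n (K : set 'rV[R]_n) : convex_set K <->
  forall x y t, K x -> K y -> 0 <= t -> t <= 1 -> K (t *: x + (1 - t) *: y).
Proof.
split=> [h x y t Kx Ky t0 t1|h x y t].
  have := h x y (Itv01 t0 t1) (mem_set Kx) (mem_set Ky).
  by move/set_mem.
move=> /set_mem Kx /set_mem Ky; apply: mem_set.
exact: (h x y t%:num).
Qed.

Lemma convex_body_unit_ball n : convex_body (@unit_ball R n).
Proof.
split; [by exists 0; rewrite /unit_ball /= enorm0|exact: compact_unit_ball|].
apply/convexP => x y t; rewrite /unit_ball/= => x1 y1 t0 t1.
rewrite (le_trans (enormD _ _))// !enormZ !ger0_norm ?subr_ge0//.
by have := enorm_ge0 x; have := enorm_ge0 y; nra.
Qed.

End euclid.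

(** * Volumes and Minkowski sums of convex bodies *)

Section bodies.
Variable R : realType.

Lemma vol_cube n (c : R) : 0 <= c -> vol (@cube R n c) = ((2 * c) ^+ n)%:E.
Proof.
move=> c0.
rewrite /vol (_ : [set t | _] =
  [set t : n.-tuple (measurableTypeR R) |
    forall i, [set` `[- c, c]] (tnth t i)]); last first.
  by apply/predeqP => t; split => h i; have := h i;
    rewrite /= in_itv/= mxE ler_norml.
rewrite (lebesgue_tuple_box (A := fun=> [set` `[- c, c]]))//.
under eq_bigr do rewrite lebesgue_measure_itv/= lte_fin -EFinB.
rewrite (eq_bigr (fun=> (2 * c)%:E)) => [|i _]; last first.
  case: ltP => [_|cc]; first by congr EFin; lra.
  by congr EFin; lra.
by rewrite prodEFin prodr_const card_ord.
Qed.

Lemma vol_compact_fin n (K : set 'rV[R]_n) : compact K -> (vol K < +oo)%E.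
Proof.
move=> cK; have [c c0 Kc] := compact_sub_cube cK.
apply: (@le_lt_trans _ _ (vol (@cube R n c))).
  apply: le_vol Kc; apply: closed_vmeasurable; apply: compact_closed => //.
  exact: compact_cube.
by rewrite vol_cube ?ltry// ltW.
Qed.

Lemma compact_vmeasurable n (K : set 'rV[R]_n) : compact K -> vmeasurable K.
Proof. by move=> cK; apply: closed_vmeasurable; exact: compact_closed. Qed.

Definition rvol n (K : set 'rV[R]_n) : R := fine (vol K).

Lemma rvolE n (K : set 'rV[R]_n) : compact K -> vol K = (rvol K)%:E.
Proof.
by move=> cK; rewrite fineK// ge0_fin_numE ?vol_ge0// vol_compact_fin.
Qed.

Lemma rvol_ge0 n (K : set 'rV[R]_n) : 0 <= rvol K.
Proof. exact/fine_ge0/vol_ge0. Qed.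

Lemma le_rvol n (K L : set 'rV[R]_n) :
  compact K -> compact L -> K `<=` L -> rvol K <= rvol L.
Proof.
move=> cK cL KL; rewrite -lee_fin -!rvolE//.
by apply: le_vol => //; exact: compact_vmeasurable.
Qed.

Lemma rvol_unit_ball_gt0 n : 0 < rvol (@unit_ball R n).
Proof.
(* With [n + 1] in place of [n], the half-side also makes sense in dimension 0. *)
have h : @cube R n (n.+1%:R^-1) `<=` @unit_ball R n.
  move=> x /enorm_coord_le h; rewrite /unit_ball/=; apply: (le_trans h).
  by rewrite ler_pdivrMr// mul1r ler_nat.
have := le_rvol (@compact_cube R n _) (@compact_unit_ball R n) h.
by apply: lt_le_trans; rewrite /rvol vol_cube ?invr_ge0//= exprn_gt0.
Qed.

Lemma mule_pI (r : R) (x y : \bar R) :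
  0 < r -> (r%:E * x = r%:E * y -> x = y)%E.
Proof.
move=> r0 rxy; apply: le_anti.
by rewrite -(@lee_pmul2l _ r%:E _ _ x)// -(@lee_pmul2l _ r%:E _ _ y)// rxy lexx.
Qed.

(** In [vol_linear_swap] take the unit ball for one set: it is invariant under orthogonal maps and
    negation, and its positive finite volume cancels. *)
Lemma vol_orth n (O : 'M[R]_n) (E : set 'rV[R]_n) :
  O *m O^T = 1%:M -> vmeasurable E -> vol [set x *m O | x in E] = vol E.
Proof.
move=> OO mE; have OO' : O^T *m O = 1%:M by exact: mulmx1C.
have uO : O^T \in unitmx by have /mulmx1_unit[] := OO.
have eO x : enorm (x *m O^T) = enorm x :> R.
  by rewrite !enormE dot_mull trmxK -mulmxA OO' mulmx1.
have := vol_linear_swap uO (compact_vmeasurable (@compact_unit_ball R n)) mE.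
rewrite (_ : [set x | unit_ball (x *m O^T)] = @unit_ball R n); last first.
  by apply/funext => x; rewrite /unit_ball/mkset eO.
rewrite (_ : [set x | unit_ball (- x)] = @unit_ball R n); last first.
  by apply/funext => x; rewrite /unit_ball/mkset enormN.
rewrite (_ : [set x *m O | x in E] = [set x | E (x *m O^T)]); last first.
  apply/predeqP => x; split => [[y Ey <-]|Ex] /=;
    first by rewrite -mulmxA OO mulmx1.
  by exists (x *m O^T) => //; rewrite -mulmxA OO' mulmx1.
have B0 := rvol_unit_ball_gt0 n.
rewrite (rvolE (@compact_unit_ball R n)) [X in _ = X -> _]muleC.
by move/(mule_pI B0).
Qed.

Definition dil n (r : R) (K : set 'rV[R]_n) := [set r *: x | x in K].

(** Again [vol_linear_swap], now against a cube, whose dilates have known volume. *)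
Lemma vol_dil n r (E : set 'rV[R]_n) : 0 < r -> vmeasurable E ->
  vol (dil r E) = ((r ^+ n)%:E * vol E)%E.
Proof.
move=> r0 mE; have rn0 : r != 0 by rewrite gt_eqF.
have uM : (r^-1)%:M \in @unitmx R n.
  by rewrite unitmxE det_scalar unitrX// unitfE invr_eq0.
have := vol_linear_swap uM (compact_vmeasurable (@compact_cube R n 1)) mE.
rewrite (_ : [set x | cube 1 (x *m _)] = @cube R n r); last first.
  apply/predeqP => x; rewrite /cube/mkset mul_mx_scalar; split=> h i;
    have := h i;
    by rewrite mxE normrM normfV (gtr0_norm r0) mulrC ler_pdivrMr// mul1r.
rewrite (_ : [set x | cube 1 (- x)] = @cube R n 1); last first.
  by apply/predeqP => x; rewrite /cube/mkset; split=> h i; have := h i;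
    rewrite mxE normrN.
rewrite (_ : [set x | E (x *m _)] = dil r E); last first.
  apply/predeqP => x; rewrite /mkset mul_mx_scalar; split => [Ex|[y Ey <-]].
    by exists (r^-1 *: x) => //; rewrite scalerA mulfV// scale1r.
  by rewrite scalerA mulVf// scale1r.
rewrite !vol_cube ?ltW// mulr1 exprMn EFinM -muleA.
rewrite [X in _ = X -> _]muleC.
by move=> h; apply/esym/(mule_pI _ h); rewrite exprn_gt0.
Qed.

(** * Minkowski sums and the stability of convex bodies *)

Definition msum n (K L : set 'rV[R]_n) := [set x + y | x in K & y in L].
Definition seg n (w : 'rV[R]_n) :=
  [set t *: w | t in [set t : R | 0 <= t <= 1]].

Lemma msumA n (K L M : set 'rV[R]_n) : msum (msum K L) M = msum K (msum L M).
Proof.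
apply/predeqP => z; split.
  move=> [_ [x Kx [y Ly <-]] [m Mm <-]].
  by exists x => //; exists (y + m); [exists y => //; exists m|rewrite addrA].
move=> [x Kx [_ [y Ly [m Mm <-]] <-]].
by exists (x + y); [exists x => //; exists y|exists m => //; rewrite addrA].
Qed.

Lemma msumC n (K L : set 'rV[R]_n) : msum K L = msum L K.
Proof.
by apply/predeqP => z; split => -[x Kx [y Ly <-]];
  exists y => //; exists x => //; rewrite addrC.
Qed.

Lemma msumAC n (K L M : set 'rV[R]_n) : msum (msum K L) M = msum (msum K M) L.
Proof. by rewrite !msumA (msumC L). Qed.

Lemma msumSS n (K K' L L' : set 'rV[R]_n) :
  K `<=` K' -> L `<=` L' -> msum K L `<=` msum K' L'.
Proof. by move=> KK' LL' _ [x Kx [y Ly <-]]; exists x;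
  [exact: KK'|exists y; [exact: LL'|]]. Qed.

Lemma seg0 n (w : 'rV[R]_n) : seg w 0.
Proof. by exists 0; rewrite /= ?lexx ?ler01 ?scale0r. Qed.

Lemma sub_msum_seg n (K : set 'rV[R]_n) w : K `<=` msum K (seg w).
Proof. by move=> x Kx; exists x => //; exists 0;
  [exact: seg0|rewrite addr0]. Qed.

Lemma compact_msum n (K L : set 'rV[R]_n) : compact K -> compact L ->
  compact (msum K L).
Proof.
move=> cK cL.
rewrite (_ : msum K L = (fun p : 'rV[R]_n * 'rV[R]_n => p.1 + p.2) @` (K `*`
  L)).
  apply: continuous_compact; last exact: compact_setX.
  by apply: continuous_subspaceT; exact: add_continuous.
apply/predeqP => z; split => [[x Kx [y Ly <-]]|[[x y] [/= Kx Ly] <-]].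
  by exists (x, y).
by exists x => //; exists y.
Qed.

Lemma body_msum n (K L : set 'rV[R]_n) :
  convex_body K -> convex_body L -> convex_body (msum K L).
Proof.
move=> [[x Kx] cK /convexP vK] [[y Ly] cL /convexP vL]; split.
- by exists (x + y); exists x => //; exists y.
- exact: compact_msum.
apply/convexP => _ _ t [a Ka [b Lb <-]] [a' Ka' [b' Lb' <-]] t0 t1.
exists (t *: a + (1 - t) *: a'); first exact: vK.
exists (t *: b + (1 - t) *: b'); first exact: vL.
by rewrite !scalerDr addrACA.
Qed.

Lemma body_image n m (f : 'rV[R]_n -> 'rV[R]_m) K :
  (forall a x y, f (a *: x + y) = a *: f x + f y) -> continuous f ->
  convex_body K -> convex_body (f @` K).
Proof.
move=> fL fc [[x Kx] cK /convexP vK]; split.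
- by exists (f x); exists x.
- by apply: continuous_compact => //; exact: continuous_subspaceT.
have f0 : f 0 = 0 by have := fL (-1) 0 0; rewrite scaler0 addr0 scaleN1r addNr.
apply/convexP => _ _ t [a Ka <-] [b Kb <-] t0 t1.
exists (t *: a + (1 - t) *: b); first exact: vK.
by rewrite fL -[(1 - t) *: b]addr0 fL f0 addr0.
Qed.

Lemma mulmx_continuous n m (M : 'M[R]_(n,
  m)) : continuous (fun x : 'rV[R]_n => x *m M).
Proof.
under eq_fun do rewrite mulmx_sum_row.
apply: continuous_big => [|i _ x]; first exact: add_continuous.
exact: continuous_comp (@coord_continuous R 1 n 0 i x)
  (@scalel_continuous R 'rV[R]_m (row i M) _).
Qed.

Lemma body_mulmx n m (M : 'M[R]_(n, m)) K :
  convex_body K -> convex_body [set x *m M | x in K].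
Proof.
apply: body_image; last exact: mulmx_continuous.
by move=> a x y; rewrite mulmxDl scalemxAl.
Qed.

Lemma body_dil n r (K : set 'rV[R]_n) : convex_body K -> convex_body (dil r K).
Proof.
move=> /(body_mulmx r%:M); rewrite (_ : [set x *m _ | x in K] = dil r K)//.
by apply/eq_imagel => x _; rewrite mul_mx_scalar.
Qed.

Lemma body_seg n (w : 'rV[R]_n) : convex_body (seg w).
Proof.
split; first by exists 0; exact: seg0.
- rewrite /seg (_ : [set t | 0 <= t <= 1] = [set` `[0, 1]]); last first.
    by apply/predeqP => t; rewrite /= in_itv.
  apply: continuous_compact; last exact: segment_compact.
  by apply: continuous_subspaceT; exact: (@scalel_continuous R 'rV[R]_n w).
apply/convexP => _ _ t [a /andP[a0 a1] <-] [b /andP[b0 b1] <-] t0 t1.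
exists (t * a + (1 - t) * b); last first.
  by rewrite !scalerA -scalerDl.
by apply/andP; split; nra.
Qed.

Lemma compact_body n (K : set 'rV[R]_n) : convex_body K -> compact K.
Proof. by case. Qed.

Lemma parallel_bodyE n (K : set 'rV[R]_n) r :
  parallel_body K r = msum K (dil r (@unit_ball R n)).
Proof.
apply/predeqP => z; split => [[x Kx [b Bb <-]]|[x Kx [_ [b Bb <-] <-]]].
  by exists x => //; exists (r *: b) => //; exists b.
by exists x => //; exists b.
Qed.

Lemma body_parallel n (K : set 'rV[R]_n) r : convex_body K ->
  convex_body (parallel_body K r).
Proof.
move=> bK; rewrite parallel_bodyE; apply: body_msum => //.
by apply: body_dil; exact: convex_body_unit_ball.
Qed.

End bodies.

(** * Adding a segment *)

Section segments.
Variable R : realType.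

(** Otherwise the gap between the slopes would overtake the gap between the constants. This turns
    bounds that are affine in the length of a segment into bounds on increments. *)
Lemma le_slope (a b a' b' : R) :
  (forall s, 0 <= s -> a + s * b <= a' + s * b') -> b <= b'.
Proof.
move=> h; rewrite leNgt; apply/negP => bb'.
have d0 : 0 < b - b' by rewrite subr_gt0.
have s0 : 0 <= (`|a' - a| + 1) / (b - b') by rewrite divr_ge0 ?(ltW d0)//
  addr_ge0.
have := h _ s0; set s := _ / _.
have sE : s * (b - b') = `|a' - a| + 1 by rewrite /s mulfVK// gt_eqF.
have := ler_norm (a' - a); lra.
Qed.

(** Cauchy's functional equation on the half-line. Enclosing [n * s] between consecutive integers
    bounds [n] times the error by [G 1], for every [n]. *)
Lemma additive_monotone_linear (G : R -> R) :
  (forall s t, 0 <= s -> 0 <= t -> G (s + t) = G s + G t) ->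
  (forall s t, 0 <= s -> s <= t -> G s <= G t) ->
  forall s, 0 <= s -> G s = s * G 1.
Proof.
move=> Gadd Gle s s0.
have G0 : G 0 = 0.
  by have := Gadd 0 0 (lexx _) (lexx _); rewrite addr0; lra.
have Gn x n : 0 <= x -> G (n%:R * x) = n%:R * G x.
  move=> x0; elim: n => [|n IHn]; first by rewrite !mul0r G0.
  by rewrite -natr1 !mulrDl !mul1r Gadd ?IHn// mulr_ge0.
have G10 : 0 <= G 1 by rewrite -G0 Gle.
apply/eqP; rewrite -subr_eq0 -normr_le0; apply/ler_addgt0Pl => e e0;
  rewrite addr0.
set c := `|_|.
have bnd n : n%:R * c <= G 1.
  have ns0 : 0 <= n%:R * s by rewrite mulr_ge0.
  have /andP[m1 m2] := truncn_itv ns0; set m := Num.truncn _ in m1 m2.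
  have h1 := Gle _ _ (ler0n _ m) m1.
  have h2 := Gle _ _ ns0 (ltW m2).
  rewrite -[m%:R]mulr1 Gn// Gn// in h1; rewrite -[m.+1%:R]mulr1 Gn// Gn// in h2.
  rewrite /c -[n%:R]ger0_norm// -normrM ler_norml; apply/andP.
  by move: m1 m2 h1 h2; rewrite -natr1; split; nra.
have e1 : 0 <= G 1 / e by rewrite divr_ge0// ltW.
have := archi_boundP e1; set n := Num.bound _ => Gn1.
have n0 : 0 < n%:R :> R by rewrite (le_lt_trans e1).
rewrite -(ler_pM2l n0) (le_trans (bnd n))//.
by rewrite -ler_pdivrMr// ltW.
Qed.

Lemma msum_segP n (K : set 'rV[R]_n) s w x : 0 <= s ->
  msum K (seg (s *: w)) x <->
  exists k a, [/\ K k, 0 <= a <= s & x = k + a *: w].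
Proof.
move=> s0; split=> [[k Kk [_ [t /andP[t0 t1] <-] <-]]|[k [a [Kk /andP[a0 as_]
  ->]]]].
  by exists k, (t * s); split => //; [apply/andP; split; nra|rewrite scalerA].
exists k => //; exists (a *: w) => //.
have [s00|s00] := eqVneq s 0.
  have -> : a = 0 by apply: le_anti; rewrite a0 -s00 as_.
  by rewrite scale0r; exact: seg0.
have s1 : 0 < s by rewrite lt_neqAle eq_sym s00.
exists (a / s); last by rewrite scalerA mulfVK.
by rewrite /= divr_ge0//= ler_pdivrMr// mul1r.
Qed.

(* On each line parallel to [w], a convex body is an interval, and lengthening
   by [t] after [s] adds the same half-open interval as lengthening by [t]. *)
Lemma segment_increment n (K : set 'rV[R]_n) w s t : convex_body K ->
  0 <= s -> 0 <= t ->
  msum K (seg ((s + t) *: w)) `\` msum K (seg (s *: w)) =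
  [set x | (msum K (seg (t *: w)) `\` K) (x - s *: w)].
Proof.
move=> [_ _ /convexP vK] s0 t0; apply/predeqP => x; split.
  move=> [/(msum_segP _ _ _ (addr_ge0 s0 t0)) [k [a [Kk /andP[a0 ast] xE]]] Nx].
  have sa : s < a.
    rewrite ltNge; apply/negP => as_; apply: Nx; apply/msum_segP => //.
    by exists k, a; split => //; apply/andP.
  split.
    apply/msum_segP => //; exists k, (a - s); split => //; first by apply/andP;
      lra.
    by rewrite xE scalerBl addrA.
  move=> Kx; apply: Nx; apply/msum_segP => //.
  by exists (x - s *: w), s; rewrite s0 lexx addrNK.
move=> [/(msum_segP _ _ _ t0) [k [c [Kk /andP[c0 ct] xE]]] Nx].
have {}xE : x = k + (c + s) *: w by rewrite scalerDl addrA -xE addrNK.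
split.
  apply/msum_segP; first exact: addr_ge0.
  by exists k, (c + s); split => //; apply/andP; lra.
move=> /(msum_segP _ _ _ s0) [k' [b [Kk' /andP[b0 bs] xE']]]; apply: Nx.
have [sb|sb] := eqVneq b s; first by rewrite xE' sb addrK.
have d0 : 0 < s - b + c by rewrite ltr_wpDr// subr_gt0 lt_neqAle sb.
(* [x - s *: w] lies between [k = x - (c + s) *: w] and [k' = x - b *: w]; [u] is the weight of [k].
   Convexity then puts the point in [K]. *)
pose u := (s - b) / (s - b + c).
have u0 : 0 <= u by rewrite divr_ge0 ?(ltW d0) ?subr_ge0.
have u1 : u <= 1 by rewrite ler_pdivrMr// mul1r lerDl.
have := vK _ _ _ Kk Kk' u0 u1; congr K.
have -> : k = x - (c + s) *: w by rewrite xE addrK.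
have -> : k' = x - b *: w by rewrite xE' addrK.
rewrite !scalerBr !scalerA addrACA -scalerDl -opprD -scalerDl addrCA subrr
  addr0 scale1r.
congr (_ - _ *: _); rewrite /u; field.
by rewrite gt_eqF.
Qed.

Lemma rvol_shift n (v : 'rV[R]_n) A : vmeasurable A ->
  rvol [set x | A (x + v)] = rvol A.
Proof. by move=> mA; rewrite /rvol vol_shift. Qed.

Lemma rvol_setD n (A B : set 'rV[R]_n) : compact A -> compact B -> A `<=` B ->
  rvol (B `\` A) = rvol B - rvol A.
Proof.
move=> cA cB AB; rewrite /rvol vol_setD ?vol_compact_fin//.
- by rewrite (rvolE cA) (rvolE cB).
- exact: compact_vmeasurable.
- exact: compact_vmeasurable.
Qed.

(** By [segment_increment] and translation invariance the added volume is additive in [s]; being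
    monotone, it is linear. *)
Lemma rvol_msum_seg n (K : set 'rV[R]_n) w s : convex_body K -> 0 <= s ->
  rvol (msum K (seg (s *: w))) =
  rvol K + s * (rvol (msum K (seg w)) - rvol K).
Proof.
move=> bK s0.
pose G s := rvol (msum K (seg (s *: w))) - rvol K.
have cS r : compact (msum K (seg (r *: w))).
  by apply: compact_body; apply: body_msum => //; exact: body_seg.
have cK := compact_body bK.
have sub r t : 0 <= r -> r <= t ->
    msum K (seg (r *: w)) `<=` msum K (seg (t *: w)).
  move=> r0 rt x /(msum_segP _ _ _ r0)[k [a [Kk /andP[a0 ar] ->]]].
  apply/msum_segP; first exact: le_trans rt.
  by exists k, a; split => //; rewrite a0 (le_trans ar).
have := @additive_monotone_linear G _ _ s s0.
rewrite /G scale1r => <-; first by rewrite addrC subrK.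
  move=> {s0}s t s0 t0.
  have := segment_increment w bK s0 t0 => /(congr1 (@rvol R n)).
  rewrite rvol_setD//; last by apply: sub => //; rewrite lerDl.
  rewrite (@rvol_shift _ (- (s *: w)) (_ `\` _)).
    rewrite rvol_setD//; first lra.
    exact: sub_msum_seg.
  by apply: measurableD; exact: compact_vmeasurable.
by move=> r t r0 rt; rewrite lerD2r le_rvol//; exact: sub.
Qed.

End segments.

(** * Functionals that are affine along segments *)

Section functionals.
Variable R : realType.

Definition dseg n (w : 'rV[R]_n) (phi : set 'rV[R]_n -> R) K :=
  phi (msum K (seg w)) - phi K.

(** A class that contains the volume and is closed under sums and under [dseg w], hence contains
    every coefficient occurring below. *)
Record segment_affine n (phi : set 'rV[R]_n -> R) : Prop := SegmentAffine {
  saff_ge0 : forall K, convex_body K -> 0 <= phi K;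
  saff_le : forall K L, convex_body K -> convex_body L -> K `<=` L ->
    phi K <= phi L;
  saff_seg : forall K w s, convex_body K -> 0 <= s ->
    phi (msum K (seg (s *: w))) = phi K + s * dseg w phi K }.

Lemma body_msum_seg n (K : set 'rV[R]_n) w :
  convex_body K -> convex_body (msum K (seg w)).
Proof. by move=> bK; apply: body_msum => //; exact: body_seg. Qed.

Lemma segment_affine_rvol n : segment_affine (@rvol R n).
Proof.
split=> [K _|K L bK bL|K w s]; first exact: rvol_ge0.
  by apply: le_rvol; exact: compact_body.
exact: rvol_msum_seg.
Qed.

Lemma segment_affine0 n : segment_affine (fun _ : set 'rV[R]_n => 0 : R).
Proof. by split=> // K w s _ _; rewrite /dseg subrr mulr0 addr0. Qed.

Lemma segment_affineD n (phi psi : set 'rV[R]_n -> R) :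
  segment_affine phi -> segment_affine psi ->
  segment_affine (fun K => phi K + psi K).
Proof.
move=> hphi hpsi; split=> [K bK|K L bK bL KL|K w s bK s0].
- by rewrite addr_ge0 ?(saff_ge0 hphi) ?(saff_ge0 hpsi).
- by rewrite lerD ?(saff_le hphi) ?(saff_le hpsi).
by rewrite (saff_seg hphi)// (saff_seg hpsi)// /dseg; ring.
Qed.

(** For monotonicity: [phi] at [K] and at [L], both lengthened by [s *: w], are affine in [s] and
    ordered for all [s], so their slopes [dseg w phi] are ordered as well. *)
Lemma segment_affine_dseg n w (phi : set 'rV[R]_n -> R) :
  segment_affine phi -> segment_affine (dseg w phi).
Proof.
move=> hphi; split=> [K bK|K L bK bL KL|K w' s bK s0].
- by rewrite subr_ge0 (saff_le hphi)//;
  [exact: body_msum_seg|exact: sub_msum_seg].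
- apply: (@le_slope _ (phi K) _ (phi L)) => s s0.
  rewrite -!(saff_seg hphi)// (saff_le hphi)//; try exact: body_msum_seg.
  exact: msumSS.
rewrite /dseg msumAC !(saff_seg hphi)//; last exact: body_msum_seg.
rewrite /dseg [msum (msum K (seg w')) _]msumAC; ring.
Qed.

Lemma dsegC n (v w : 'rV[R]_n) phi : dseg v (dseg w phi) = dseg w (dseg v phi).
Proof. by apply/funext => K; rewrite /dseg msumAC; ring. Qed.

Lemma dsegZ n (phi : set 'rV[R]_n -> R) K s w : segment_affine phi ->
  convex_body K -> 0 <= s -> dseg (s *: w) phi K = s * dseg w phi K.
Proof. by move=> hphi bK s0;
  rewrite {1}/dseg saff_seg// addrAC subrr add0r. Qed.

Lemma seg_add n (v w : 'rV[R]_n) : seg (v + w) `<=` msum (seg v) (seg w).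
Proof.
by move=> _ [t t01 <-]; exists (t *: v); [exists t|exists (t *: w);
  [exists t|rewrite scalerDr]].
Qed.

(** A segment along [v + w] lies in the parallelogram on [v] and [w]. At scale [e] the parallelogram
    costs an extra [e * e * c], which is negligible to first order. *)
Lemma dsegD n (phi : set 'rV[R]_n -> R) K v w : segment_affine phi ->
  convex_body K -> dseg (v + w) phi K <= dseg v phi K + dseg w phi K.
Proof.
move=> hphi bK.
set c := dseg v (dseg w phi) K.
have main e : 0 <= e ->
    e * dseg (v + w) phi K <= e * (dseg v phi K + dseg w phi K) + e * e * c.
  move=> e0.
  have : phi (msum K (seg (e *: (v + w)))) <=
      phi (msum (msum K (seg (e *: v))) (seg (e *: w))).
    rewrite (saff_le hphi)//; do ?exact: body_msum_seg.
      by apply: body_msum_seg; exact: body_msum_seg.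
    rewrite msumA scalerDr; apply: msumSS => //; exact: seg_add.
  rewrite !(saff_seg hphi)//; last exact: body_msum_seg.
  have := saff_seg (segment_affine_dseg w hphi) v bK e0.
  rewrite -/c => ->; nra.
have [c0|c0] := leP c 0.
  by have := main 1 ler01; nra.
rewrite leNgt; apply/negP => lt.
set d := dseg (v + w) phi K - (dseg v phi K + dseg w phi K).
have d0 : 0 < d by rewrite subr_gt0.
(* At this scale the error term per unit, [e * c], is half of the supposed excess [d]. *)
have e0 : 0 < d / (2 * c) by rewrite divr_gt0// mulr_gt0.
have := main _ (ltW e0); set e := d / _.
have ec : e * c = d / 2 by rewrite /e; field; rewrite gt_eqF.
rewrite -mulrA ec -mulrDr ler_pM2l//.
rewrite /d; lra.
Qed.

(** * Zonotopes and expansion of a functional along them *)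

Fixpoint zon n (ws : seq 'rV[R]_n) (K : set 'rV[R]_n) :=
  if ws is w :: ws' then zon ws' (msum K (seg w)) else K.

Lemma body_zon n (ws : seq 'rV[R]_n) K : convex_body K ->
  convex_body (zon ws K).
Proof. by elim: ws K => //= w ws IH K bK; apply: IH; exact: body_msum_seg. Qed.

(** The [k]-th elementary symmetric polynomial in the commuting operators [dseg w], [w] in [ws],
    applied to [phi]. *)
Fixpoint zcoef n (ws : seq 'rV[R]_n) k (phi : set 'rV[R]_n -> R) K : R :=
  match ws, k with
  | [::], 0 => phi K
  | [::], _.+1 => 0
  | w :: ws', 0 => zcoef ws' 0 phi K
  | w :: ws', k'.+1 => zcoef ws' k'.+1 phi K + dseg w (zcoef ws' k' phi) K
  end.

Lemma segment_affine_zcoef n (ws : seq 'rV[R]_n) k phi :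
  segment_affine phi -> segment_affine (zcoef ws k phi).
Proof.
move=> hphi; elim: ws k => [|w ws IH] [|k] //=; first exact: segment_affine0.
by apply: segment_affineD => //; exact: segment_affine_dseg.
Qed.

Lemma zcoef_size n (ws : seq 'rV[R]_n) k phi K :
  (size ws < k)%N -> zcoef ws k phi K = 0.
Proof.
elim: ws k K => [|w ws IH] [|k] K //= wk.
by rewrite /dseg !IH ?subrr ?addr0// ltnW.
Qed.

(** The coefficients for the remaining segments are themselves affine along [w], so each segment
    contributes a factor [1 + r * dseg w]. *)
Lemma zon_expand n (ws : seq 'rV[R]_n) phi K r : segment_affine phi ->
  convex_body K -> 0 <= r ->
  phi (zon [seq r *: w | w <- ws] K) =
  \sum_(k < (size ws).+1) r ^+ k * zcoef ws k phi K.
Proof.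
move=> hphi + r0; elim: ws K => [|w ws IH] K bK.
  by rewrite big_ord_recl big_ord0 /= mul1r addr0.
rewrite [LHS]/= IH; last exact: body_msum_seg.
under eq_bigr => k _ do
  rewrite (saff_seg (segment_affine_zcoef ws k hphi))// mulrDr mulrA -exprSr.
rewrite big_split/= [RHS]big_ord_recl [RHS]/=.
under [in RHS]eq_bigr => k _ do rewrite /= mulrDr.
rewrite big_split/= addrA; congr (_ + _).
rewrite [in RHS]big_ord_recr/= [bump 0 _]/bump /= add1n (zcoef_size _ _ (ltnSn
  _)) mulr0 addr0.
by rewrite [LHS]big_ord_recl.
Qed.

Lemma zcoef_dseg n (ws : seq 'rV[R]_n) k p phi :
  zcoef ws k (dseg p phi) = dseg p (zcoef ws k phi).
Proof.
elim: ws k => [|w ws IH] [|k]; apply/funext => K //=.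
- by rewrite /dseg subrr.
- by rewrite IH.
rewrite !IH dsegC /dseg/=; ring.
Qed.

(** Agreement is only asked on convex bodies, so that [dseg_lift] can be applied under [zcoef]. *)
Lemma eq_zcoef n (ws : seq 'rV[R]_n) k phi psi K :
  (forall L, convex_body L -> phi L = psi L) -> convex_body K ->
  zcoef ws k phi K = zcoef ws k psi K.
Proof.
move=> e; elim: ws k K => [|w ws IH] [|k] K bK //=; first exact: e.
- exact: IH.
by rewrite /dseg !IH//; exact: body_msum_seg.
Qed.

Lemma image_msum_seg n m (M : 'M[R]_(n, m)) K w :
  [set x *m M | x in msum K (seg w)] =
  msum [set x *m M | x in K] (seg (w *m M)).
Proof.
apply/predeqP => z; split.
  move=> [_ [x Kx [_ [t t01 <-] <-]] <-].
  exists (x *m M); first by exists x.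
  by exists (t *: (w *m M)); [exists t|rewrite mulmxDl scalemxAl].
move=> [_ [x Kx <-] [_ [t t01 <-] <-]].
exists (x + t *: w); last by rewrite mulmxDl scalemxAl.
by exists x => //; exists (t *: w) => //; exists t.
Qed.

Lemma zcoef_image n m (M : 'M[R]_(n, m)) (ws : seq 'rV[R]_n) k phi K :
  zcoef [seq w *m M | w <- ws] k phi [set x *m M | x in K] =
  zcoef ws k (fun L => phi [set x *m M | x in L]) K.
Proof.
elim: ws k K => [|w ws IH] [|k] K //=.
by rewrite /dseg -image_msum_seg !IH.
Qed.

End functionals.

(** * Shadow systems *)

Section lift.
Variable R : realType.
Local Notation mR := (measurableTypeR R).
Local Notation mu := (@lebesgue_measure R).

(* Projection of [R * R^d] onto [R^d] along [(1, y)]. *)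
Definition proj_mx d (y : 'rV[R]_d) : 'M[R]_(1 + d, d) := col_mx (- y) 1%:M.

Lemma mul_proj_mx d (y : 'rV[R]_d) (h : R) z :
  row_mx h%:M z *m proj_mx y = z - h *: y.
Proof. by rewrite mul_row_col mulmx1 mul_scalar_mx scalerN addrC. Qed.

Lemma slice_msum d (L : set 'rV[R]_(1 + d)) y s x : 0 <= s ->
  slice (msum L (seg (s *: row_mx 1%:M y))) x `<=`
  [set z | [set u *m proj_mx y | u in L] (z - x *: y)].
Proof.
move=> s0 z /(msum_segP _ _ _ s0)[u [a [Lu a0s E]]].
exists u => //; rewrite -mul_proj_mx E mulmxDl -scalemxAl mul_proj_mx.
by rewrite scale1r subrr scaler0 addr0.
Qed.

(** The first coordinates of points of [L] lie in [[- c, c]], so at these heights the parameter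
    [x - u 0 0] that carries [u] to height [x] always falls in [[0, s]]. *)
Lemma slice_msum_eq d (L : set 'rV[R]_(1 + d)) y c s x :
  L `<=` cube c -> c <= x -> x <= s - c -> 0 <= s ->
  slice (msum L (seg (s *: row_mx 1%:M y))) x =
  [set z | [set u *m proj_mx y | u in L] (z - x *: y)].
Proof.
move=> Lc cx xs s0; apply/seteqP; split; first exact: slice_msum.
move=> z [u Lu E]; apply/msum_segP => //.
have uE : u = row_mx (u 0 0)%:M (rsubmx u).
  rewrite -[LHS]hsubmxK; congr row_mx; rewrite [LHS]mx11_scalar; congr _%:M.
  by rewrite mxE; congr (u _ _); exact: val_inj.
exists u, (x - u 0 0); split => //.
  have := Lc _ Lu 0; rewrite ler_norml => /andP[? ?]; apply/andP; lra.
rewrite uE mul_proj_mx in E; rewrite {1}uE scale_row_mx add_row_mx;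
  congr row_mx.
  by rewrite scalemx1 -raddfD addrC subrK.
have -> : rsubmx u = z - x *: y + u 0 0 *: y by rewrite -E subrK.
by rewrite scalerBl [x *: y - _]addrC addrA addrK subrK.
Qed.

Lemma slice_msum_out d (L : set 'rV[R]_(1 + d)) y c s x : 0 <= s ->
  L `<=` cube c -> ~ (- c <= x <= s + c) ->
  slice (msum L (seg (s *: row_mx 1%:M y))) x = set0.
Proof.
move=> s0 Lc Nx; apply/seteqP;
  split => // z /(msum_segP _ _ _ s0)[u [a [Lu /andP[a0 as_] E]]].
apply: Nx; have := Lc _ Lu 0; rewrite ler_norml => /andP[? ?].
have -> : x = u 0 0 + a; last by apply/andP; lra.
have /matrixP/(_ 0 (lshift d 0)) := E.
rewrite row_mxEl !mxE/= mulr1n (_ : lshift d 0 = 0); last exact: val_inj.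
by case: splitP => // j _; rewrite ord1 mxE/= mulr1n mulr1.
Qed.

(** Integrate over the height: the slice volume never exceeds [V], equals [V] on [[c, s - c]] and
    vanishes outside [[- c, s + c]]. *)
Lemma rvol_lift_bounds d (L : set 'rV[R]_(1 + d)) y c s : convex_body L ->
  L `<=` cube c -> 0 <= c -> 2 * c <= s ->
  let V := rvol [set u *m proj_mx y | u in L] in
  let W := rvol (msum L (seg (s *: row_mx 1%:M y))) in
  (s - 2 * c) * V <= W /\ W <= (s + 2 * c) * V.
Proof.
move=> bL Lc c0 cs V W.
have s0 : 0 <= s by lra.
have bP : convex_body [set u *m proj_mx y | u in L] by exact: body_mulmx.
have bS : convex_body (msum L (seg (s *: row_mx 1%:M y))) by exact:
  body_msum_seg.
have mS := compact_vmeasurable (compact_body bS).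
have mP := compact_vmeasurable (compact_body bP).
have V0 : (0 <= V%:E)%E by rewrite lee_fin; exact: rvol_ge0.
have volP x : vol [set z | [set u *m proj_mx y | u in L] (z - x *: y)] = V%:E.
  by rewrite (vol_shift _ mP) rvolE//; exact: compact_body.
have WE : W%:E = (\int[mu]_x vol (slice (msum L (seg (s *: row_mx 1%:M y)))
  x))%E.
  by rewrite -vol_slice rvolE//; exact: compact_body.
have mf := measurable_fun_slice mS.
have itv a b : a <= b -> mu [set` `[a, b]] = (b - a)%:E.
  rewrite le_eqVlt lebesgue_measure_itv/= lte_fin => /orP[/eqP->|->].
    by rewrite ltxx subrr.
  by rewrite EFinB.
have two a b : a <= b -> (\int[mu]_x ((\1_[set` `[a,
  b]] x)%:E * V%:E) = ((b - a) * V)%:E)%E.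
  move=> ab; rewrite EFinM -itv//; apply: integral_two_valued => //.
  - by move=> x xab; rewrite indicE mem_set// mul1e.
  - by move=> x xab; rewrite indicE memNset// mul0e.
have m2 a b : measurable_fun [set: mR] (fun x => (\1_[set` `[a,
  b]] x)%:E * V%:E)%E.
  under eq_fun do rewrite muleC.
  by apply: measurable_funeM; apply/measurable_EFinP; exact: measurable_indic.
have g2 a b x : (0 <= (\1_[set` `[a, b]] x)%:E * V%:E)%E.
  by rewrite mule_ge0// lee_fin.
split; rewrite -lee_fin WE.
  have -> : (s - 2 * c) * V = ((s - c) - c) * V by ring.
  rewrite -two; last lra.
  apply: ge0_le_integral => //.
  move=> x _; rewrite indicE.
  have [/set_mem|_] := boolP (x \in _); last by rewrite mul0e vol_ge0.
  rewrite /= in_itv/= => /andP[cx xs].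
  by rewrite (slice_msum_eq y Lc cx xs s0) volP mul1e.
have -> : (s + 2 * c) * V = ((s + c) - (- c)) * V by ring.
rewrite -two; last lra.
apply: ge0_le_integral => //.
move=> x _; rewrite indicE.
have [_|/negP Nx] := boolP (x \in _).
  rewrite mul1e -(volP x); apply: le_vol.
  - exact: vmeasurable_slice.
  - exact: vmeasurable_shift.
  - exact: slice_msum.
rewrite (slice_msum_out y s0 Lc) ?vol_set0 ?mul0e// => xc; apply: Nx.
by apply: mem_set; rewrite /= in_itv.
Qed.

(** The volume of the lengthened body is affine in the length with slope [D], while
    [rvol_lift_bounds] encloses it between two affine functions of slope [V]. *)
Lemma dseg_lift d (L : set 'rV[R]_(1 + d)) y : convex_body L ->
  dseg (row_mx 1%:M y) (@rvol R _) L = rvol [set u *m proj_mx y | u in L].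
Proof.
move=> bL; have [c c0 Lc] := compact_sub_cube (compact_body bL).
set D := dseg _ _ _; set V := rvol [set u *m proj_mx y | u in L].
(* The length is [s + 2 * c], as [rvol_lift_bounds] requires at least [2 * c]. *)
have h s : 0 <= s -> (s + 2 * c - 2 * c) * V <= rvol L + (s + 2 * c) * D /\
    rvol L + (s + 2 * c) * D <= (s + 2 * c + 2 * c) * V.
  move=> s0; have sc0 : 0 <= s + 2 * c by lra.
  rewrite -(saff_seg (@segment_affine_rvol R (1 + d)) _ bL sc0).
  by apply: rvol_lift_bounds => //; lra.
apply: le_anti; apply/andP; split.
  apply: (@le_slope _ (rvol L + 2 * c * D) _ (4 * c * V)) => s /h [_]; nra.
apply: (@le_slope _ 0 _ (rvol L + 2 * c * D)) => s /h [+ _]; nra.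
Qed.

(* The functional [K |-> zcoef ws k rvol K] is convex along the shadow system
   [y |-> proj_mx y L], because lifting turns it into a directional derivative
   in [(1, y)]. *)
Lemma zcoef_shadow_convex d (ws : seq 'rV[R]_d) k (L : set 'rV[R]_(1 + d)) y y'
  t :
  let F y := zcoef ws k (@rvol R d) [set u *m proj_mx y | u in L] in
  convex_body L -> 0 <= t -> t <= 1 ->
  F (t *: y + (1 - t) *: y') <= t * F y + (1 - t) * F y'.
Proof.
move=> F bL t0 t1.
pose ws' := [seq (row_mx 0 w : 'rV[R]_(1 + d)) | w <- ws].
pose phi := zcoef ws' k (@rvol R (1 + d)).
have phiP : segment_affine phi by
  exact/segment_affine_zcoef/segment_affine_rvol.
have FE z : F z = dseg (row_mx 1%:M z) phi L.
  (* The lifted directions [(0, w)] project back to [w] for every [z], so one functional [phi]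
     serves all shadows. *)
  have wsE : ws = [seq w *m proj_mx z | w <- ws'].
    rewrite -map_comp -[LHS]map_id; apply: eq_map => w /=.
    by rewrite mul_row_col mul0mx mulmx1 add0r.
  rewrite /F wsE zcoef_image -zcoef_dseg; apply: eq_zcoef => // K bK.
  by rewrite dseg_lift.
rewrite !FE.
have -> : row_mx 1%:M (t *: y + (1 - t) *: y') =
    t *: row_mx 1%:M y + (1 - t) *: row_mx 1%:M y' :> 'rV[R]_(1 + d).
  by rewrite !scale_row_mx add_row_mx -scalerDl [t + _]addrC subrK scale1r.
have t1' : 0 <= 1 - t by rewrite subr_ge0.
by rewrite -!dsegZ//; exact: dsegD.
Qed.

End lift.

(** * Zonotopes approximating the ball *)

Section ball_zonotope.
Variables (R : realType) (n : nat).
Implicit Types (u v w : 'rV[R]_n) (ws : seq 'rV[R]_n).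

Lemma enormB_continuous (c : 'rV[R]_n) : continuous (fun u => enorm (u - c)).
Proof.
have h : continuous (fun u : 'rV[R]_n => u - c).
  by move=> u; apply: continuousB; [exact: cvg_id|exact: cst_continuous].
by move=> u; exact: continuous_comp (h u) (@enorm_continuous R n _).
Qed.

(** Support function of the centred zonotope, the sum of the segments from [- w] to [w]. *)
Definition zsupp ws u : R := \sum_(w <- ws) `|dot u w|.

Lemma zsuppD ws u v : zsupp ws (u + v) <= zsupp ws u + zsupp ws v.
Proof. by rewrite -big_split ler_sum// => w _; rewrite dotDl ler_normD. Qed.

Lemma zsuppZ ws a u : zsupp ws (a *: u) = `|a| * zsupp ws u.
Proof. by rewrite mulr_sumr; apply: eq_bigr => w _; rewrite dotZl normrM. Qed.

Lemma zsupp_mapZ ws a u : 0 <= a ->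
  zsupp [seq a *: w | w <- ws] u = a * zsupp ws u.
Proof.
move=> a0; rewrite /zsupp big_map mulr_sumr; apply: eq_bigr => w _.
by rewrite dotZr normrM ger0_norm.
Qed.

Lemma zsupp_orth ws u (O : 'M[R]_n) :
  zsupp [seq w *m O^T | w <- ws] u = zsupp ws (u *m O).
Proof. by rewrite /zsupp big_map; apply: eq_bigr => w _; rewrite dot_mull. Qed.

Lemma zsupp_flatten (wss : seq (seq 'rV[R]_n)) u :
  zsupp (flatten wss) u = \sum_(ws <- wss) zsupp ws u.
Proof. by rewrite /zsupp big_flatten. Qed.

(** In terms of support functions: some centred zonotope lies between the unit ball and its
    [rho]-fold dilate. *)
Definition ball_approx (rho : R) := exists ws, forall u,
  enorm u <= zsupp ws u /\ zsupp ws u <= rho * enorm u.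

Lemma ball_approx_unit ws rho :
  (forall u, enorm u = 1 -> 1 <= zsupp ws u /\ zsupp ws u <= rho) ->
    ball_approx rho.
Proof.
move=> h; exists ws => u; have [->|u0] := eqVneq u 0.
  rewrite -[X in zsupp _ X](scale0r (0 : 'rV[R]_n)) zsuppZ normr0 mul0r.
  by rewrite enorm0 mulr0 lexx.
have e0 := enorm_gt0 u0.
have [] := h ((enorm u)^-1 *: u).
  by rewrite enormZ ger0_norm ?invr_ge0 ?enorm_ge0// mulVf// gt_eqF.
have -> : zsupp ws u = enorm u * zsupp ws ((enorm u)^-1 *: u).
  by rewrite zsuppZ ger0_norm ?invr_ge0 ?enorm_ge0// mulrA mulfV ?mul1r//
    gt_eqF.
by move=> h1 h2; rewrite ler_peMr ?(ltW e0)// [rho * _]mulrC ler_pM2l.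
Qed.

Lemma ball_approx_le rho rho' : rho <= rho' -> ball_approx rho ->
  ball_approx rho'.
Proof.
move=> rr [ws h]; exists ws => u; have [h1 h2] := h u; split => //.
by rewrite (le_trans h2)// ler_wpM2r ?enorm_ge0.
Qed.

Lemma ball_approx_basis : ball_approx n%:R.
Proof.
exists [seq delta_mx 0 i | i <- enum 'I_n] => u.
have -> : zsupp [seq delta_mx 0 i | i <- enum 'I_n] u = \sum_i `|u 0 i|.
  rewrite /zsupp big_map big_enum/=; apply: eq_bigr => i _; 
  by rewrite dot_delta.
split; first exact: enorm_le_sum.
rewrite (le_trans (ler_sum _ (fun i _ => coord_le_enorm u i)))//.
by rewrite sumr_const card_ord mulr_natl.
Qed.

Lemma enorm_orth (O : 'M[R]_n) u : O *m O^T = 1%:M -> enorm (u *m O) = enorm u.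
Proof. by move=> OO; rewrite !enormE dot_mull -mulmxA OO mulmx1. Qed.

(** For [u != v], the Householder reflection in the hyperplane orthogonal to [u - v]. *)
Lemma reflection_exists u v : enorm u = 1 -> enorm v = 1 ->
  exists O : 'M[R]_n, O *m O^T = 1%:M /\ u *m O = v.
Proof.
move=> u1 v1; have [<-|uv] := eqVneq u v.
  by exists 1%:M; rewrite trmx1 !mulmx1.
pose w := u - v; have w0 : 0 < dot w w.
  by rewrite -sqr_enorm exprn_gt0// enorm_gt0// subr_eq0.
have wE : dot w w = 2 * dot u w.
  rewrite /w !(dotDl, dotDr, dotNl, dotNr) -!sqr_enorm u1 v1 (dotC v u); ring.
pose a := 2 / dot w w.
exists (1%:M - a *: (w^T *m w)).
have mulO x : x *m (1%:M - a *: (w^T *m w)) = x - (a * dot x w) *: w.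
  rewrite mulmxBr mulmx1 -scalemxAr mulmxA.
  by rewrite [x *m w^T]mx11_scalar -dotE mul_scalar_mx scalerA.
split.
  have -> : (1%:M - a *: (w^T *m w))^T = 1%:M - a *: (w^T *m w).
    apply/matrixP => i j; rewrite !mxE eq_sym; congr (_ - _ * _).
    by apply: eq_bigr => k _; rewrite !mxE mulrC.
  apply/row_matrixP => i; rewrite -[1%:M in RHS]mulmx1 !row_mul.
  set e := row i 1%:M.
  rewrite [row i (_ - _)](_ : _ = e *m (1%:M - a *: (w^T *m w))); last first.
    by rewrite -row_mul mul1mx.
  rewrite !mulO dotDl dotNl dotZl mulmx1.
  have -> : a * (dot e w - a * dot e w * dot w w) = - (a * dot e w).
    by rewrite /a; field; rewrite gt_eqF.
  by rewrite scaleNr opprK subrK.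
rewrite mulO wE in w0 *.
have -> : a * dot u w = 1.
  by rewrite /a wE; field; rewrite gt_eqF//; lra.
by rewrite scale1r /w opprB addrC subrK.
Qed.

Lemma sphere_net (eta : R) : 0 < eta -> exists cs : seq 'rV[R]_n,
  (forall c, c \in cs -> enorm c = 1) /\
  (forall u, enorm u = 1 -> exists2 c, c \in cs & enorm (u - c) < eta).
Proof.
move=> eta0; pose S : set 'rV[R]_n := [set u | enorm u = 1].
have cS : compact S.
  apply: (subclosed_compact _ (@compact_unit_ball R n)).
    apply: (@preimage_closed _ _ (@enorm R n) [set 1]).
      by move=> x _; exact: enorm_continuous.
    exact: closed_eq.
  by move=> u Su; rewrite /unit_ball/= Su.
move: cS; rewrite compact_cover => /(_ _ S (fun c => [set u | enorm (u - c) <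
  eta])).
case.
- move=> c Sc; apply: (@open_comp _ _ (fun u => enorm (u - c)) [set r | r <
  eta]).
    by move=> u _; exact: enormB_continuous.
  exact: open_lt.
- by move=> u Su; exists u => //=; rewrite subrr enorm0.
move=> D DS cov; exists (finmap.enum_fset D); split.
  by move=> c cD; have := DS _ cD; rewrite inE.
by move=> u u1; have [c cD] := cov _ u1; exists c.
Qed.

(* Averaging over finitely many rotations lowers the maximum of the support
   function on the sphere, by an amount controlled uniformly. *)
Lemma ball_approx_improve (rho0 : R) : 1 < rho0 -> exists2 delta, 0 < delta &
  forall rho, rho0 <= rho -> rho <= rho0 + 1 -> ball_approx rho ->
    ball_approx (rho - delta).
Proof.
(* Chosen so that [(rho0 + 1) * eta = (rho0 - 1) / 4]: as [rho <= rho0 + 1], this bounds the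
   variation of the support function within distance [eta]. *)
move=> r1; pose eta := (rho0 - 1) / (4 * (rho0 + 1)).
have r10 : 0 < rho0 + 1 by lra.
have eta0 : 0 < eta by rewrite divr_gt0 ?mulr_gt0 ?subr_gt0.
have [cs [cs1 csP]] := sphere_net eta0.
pose N : R := (size cs).+1%:R.
have N0 : 0 < N by rewrite ltr0Sn.
have N1 : 1 <= N by rewrite ler1n.
exists ((rho0 - 1) / (4 * N)).
  by rewrite divr_gt0 ?mulr_gt0 ?subr_gt0.
move=> rho rr rr1 [ws h].
have dN : (rho0 - 1) / (4 * N) <= (rho0 - 1) / 4.
  rewrite ler_wpM2l ?subr_ge0 ?(ltW r1)// lef_pV2 ?posrE ?mulr_gt0//; lra.
(* Either the support function is at most the midpoint of 1 and [rho0] at some unit vector [u0], or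
   it exceeds that midpoint everywhere on the sphere and shrinking the zonotope suffices. *)
have [[u0 u01 hu0]|Nu0] := pselect (exists2 u0,
  enorm u0 = 1 & zsupp ws u0 <= (1 + rho0) / 2); last first.
  apply: (@ball_approx_unit [seq (2 / (1 + rho0)) *: w | w <- ws]) => u u1.
  have a0 : 0 < 1 + rho0 by lra.
  rewrite zsupp_mapZ ?divr_ge0 ?(ltW a0)//.
  have [_] := h u; rewrite u1 mulr1 => hu.
  have hu' : (1 + rho0) / 2 < zsupp ws u.
    by rewrite ltNge; apply/negP => ?; apply: Nu0; exists u.
  rewrite mulrAC ler_pdivlMr// ler_pdivrMr//; split; first lra.
  have : (rho - (rho0 - 1) / 4) * (1 + rho0) <= (rho - (rho0 - 1) / (4 * N)) *
    (1 + rho0).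
    by rewrite ler_pM2r// lerD2l lerN2.
  apply: le_trans.
  have : 0 <= (rho - rho0) * (rho0 - 1) by rewrite mulr_ge0; lra.
  have := sqr_ge0 (rho0 - 1); rewrite expr2; nra.
have refl c : exists O : 'M[R]_n, O *m O^T = 1%:M /\ (enorm c = 1 ->
  c *m O = u0).
  have [c1|Nc1] := pselect (enorm c = 1).
    by have [Q [QQ cQ]] := reflection_exists c1 u01; exists Q.
  by exists 1%:M; rewrite trmx1 mulmx1.
pose O c := projT1 (cid (refl c)).
have OO c : O c *m (O c)^T = 1%:M by rewrite /O; case: cid => ? [].
have cO c : enorm c = 1 -> c *m O c = u0 by rewrite /O; case: cid => ? [].
pose ws' := [seq N^-1 *: w | w <- ws].
(* Average the zonotope with one copy for each net point [c], moved so that its value at [c] is the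
   small value at [u0]. *)
apply: (@ball_approx_unit (flatten (ws' :: [seq [seq w *m (O c)^T | w <- ws'] |
  c <- cs]))).
move=> u u1; rewrite zsupp_flatten big_cons big_map.
under eq_bigr do rewrite zsupp_orth.
have hO c : enorm (u *m O c) = 1 by rewrite enorm_orth.
have Ni0 : 0 <= N^-1 by rewrite invr_ge0 ltW.
have ws'E x : zsupp ws' x = N^-1 * zsupp ws x by rewrite zsupp_mapZ.
under eq_bigr do rewrite ws'E.
rewrite ws'E -mulr_sumr -mulrDr.
have [hu1 hu2] := h u; rewrite u1 mulr1 in hu1 hu2.
have hc c : 1 <= zsupp ws (u *m O c) <= rho.
  by have [] := h (u *m O c); rewrite hO mulr1 => -> ->.
have NE : N = 1 + (size cs)%:R by rewrite /N -natr1 addrC.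
split.
  rewrite ler_pdivlMl// mulr1 NE lerD//.
  rewrite -sum1_size natr_sum ler_sum// => c _.
  by have /andP[] := hc c.
have [c ccs uc] := csP _ u1.
(* Near [c] the value is at most [(1 + rho0) / 2 + (rho0 - 1) / 4], and [rho0 <= rho]. One term of
   the average thus gains [(rho0 - 1) / 4] over the bound [rho]. *)
have small : zsupp ws (u *m O c) <= rho - (rho0 - 1) / 4.
  rewrite -[u](subrK c) mulmxDl (le_trans (zsuppD _ _ _))// cO ?cs1//.
  have [_] := h ((u - c) *m O c); rewrite enorm_orth//.
  have : rho * enorm (u - c) <= (rho0 + 1) * eta.
    by rewrite ler_pM// ?enorm_ge0 ?(ltW uc)//; lra.
  have -> : (rho0 + 1) * eta = (rho0 - 1) / 4.
    by rewrite /eta; field; rewrite gt_eqF.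
  move=> ? ?; lra.
rewrite ler_pdivrMl//.
have -> : N * (rho - (rho0 - 1) / (4 * N)) = N * rho - (rho0 - 1) / 4.
  by field; rewrite gt_eqF.
rewrite NE mulrDl mul1r -addrA lerD//.
rewrite (big_rem c)//=.
have -> : (size cs)%:R * rho = rho + (size (rem c cs))%:R * rho.
  rewrite size_rem//; have : (0 < size cs)%N by case: (cs) ccs.
  by move=> /prednK <-; rewrite -natr1 mulrDl mul1r addrC.
have : \sum_(y <- rem c cs) zsupp ws (u *m O y) <= (size (rem c cs))%:R * rho.
  rewrite -sum1_size natr_sum mulr_suml ler_sum// => y _.
  by have /andP[] := hc y; rewrite mul1r.
lra.
Qed.

(** The infimum of the attainable ratios is 1: if it were larger, the uniform gain of
    [ball_approx_improve] would lead from a ratio close to the infimum to one below it. *)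
Lemma ball_approx_all (e : R) : 0 < e -> ball_approx (1 + e).
Proof.
move=> e0.
pose A : set R := [set rho | 1 <= rho /\ ball_approx rho].
have A0 : A (Num.max 1 n%:R).
  split; first by rewrite le_max lexx.
  by apply: ball_approx_le ball_approx_basis; rewrite le_max lexx orbT.
have lbA : lbound A 1 by move=> x [].
have infA : has_inf A by split; [exists (Num.max 1 n%:R)|exists 1].
have inf1 : inf A <= 1.
  rewrite leNgt; apply/negP => i1.
  have [delta d0 H] := ball_approx_improve i1.
  have m0 : 0 < Num.min delta 1 by rewrite lt_min d0 ltr01.
  have [rho [r1 Ar] rlt] := inf_adherent m0 infA.
  have ir : inf A <= rho by apply: ge_inf => //; exists 1.
  have rd : rho < inf A + delta.
    by rewrite (lt_le_trans rlt)// lerD2l ge_min lexx.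
  have rd1 : rho <= inf A + 1.
    by rewrite (le_trans (ltW rlt))// lerD2l ge_min lexx orbT.
  have good := H _ ir rd1 Ar.
  have : inf A <= Num.max 1 (rho - delta).
    apply: ge_inf; first by exists 1.
    split; first by rewrite le_max lexx.
    by apply: ball_approx_le good; rewrite le_max lexx orbT.
  by rewrite leNgt gt_max i1 ltrBlDr rd.
have [rho [_ Ar] rlt] := inf_adherent e0 infA.
by apply: ball_approx_le Ar; lra.
Qed.

(** The segment from 0 to [2 *: w] is the centred segment from [- w] to [w] translated by [w]; this
    explains the factor 2 and the subtracted sum. *)
Lemma zon_support ws (K : set 'rV[R]_n) x : zon [seq 2 *: w | w <- ws] K x ->
  exists2 k, K k & forall u,
    dot u (x - \sum_(w <- ws) w) <= dot u k + zsupp ws u.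
Proof.
elim: ws K => [|w ws IH] K /=.
  by move=> Kx; exists x => // u; rewrite /zsupp !big_nil subr0 addr0.
move=> /IH[_ [k Kk [_ [t /andP[t0 t1] <-] <-]] h]; exists k => // u.
have := h u; rewrite /zsupp !big_cons !(dotDr, dotNr, dotZr).
have : (2 * t - 1) * dot u w <= `|dot u w|.
  rewrite (le_trans (ler_norm _))// normrM ler_piMl// ler_norml.
    by apply/andP; split; lra.
lra.
Qed.

Lemma zon_vertex ws (K : set 'rV[R]_n) k u : K k ->
  exists2 x, zon [seq 2 *: w | w <- ws] K x &
    dot u (x - \sum_(w <- ws) w) = dot u k + zsupp ws u.
Proof.
elim: ws K k => [|w ws IH] K k Kk /=.
  by exists k => //; rewrite /zsupp !big_nil subr0 addr0.
(* The endpoint of the segment on which [dot u] is largest. *)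
pose t : R := if 0 <= dot u w then 1 else 0.
have Kk' : msum K (seg (2 *: w)) (k + t *: (2 *: w)).
  exists k => //; exists (t *: (2 *: w)) => //; exists t => //.
  by rewrite /t /=; case: ifP; rewrite ?ler01 ?lexx.
have [x xz xE] := IH _ _ Kk'; exists x => //.
move: xE; rewrite /zsupp !big_cons !(dotDr, dotNr, dotZr) /t.
case: ifPn => [h|].
  by rewrite (ger0_norm h); lra.
by rewrite -ltNge => h; rewrite (ltr0_norm h); lra.
Qed.

Lemma dot_subZ u v t :
  dot (u - t *: v) (u - t *: v) = dot u u - 2 * t * dot u v + t * t * dot v v.
Proof.
by rewrite !(dotDl, dotDr, dotNl, dotNr, dotZl, dotZr) (dotC v u); ring.
Qed.

(** Separation with [u = x - p], where [p] is the point of [Z] nearest to [x]: if [z] made an acute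
    angle with [u] at [p], moving from [p] towards [z] would come closer to [x]. *)
Lemma closest_point (Z : set 'rV[R]_n) x : convex_body Z -> ~ Z x ->
  exists u, forall z, Z z -> dot u z < dot u x.
Proof.
move=> [Z0 cZ /convexP vZ] NZx.
have [p pZ pmin] := EVT_min_rV Z0 cZ (continuous_subspaceT (@enormB_continuous
  x)).
exists (x - p) => z Zz; move/set_mem: pZ => Zp.
have xp0 : 0 < dot (x - p) (x - p).
  rewrite -sqr_enorm exprn_gt0// enorm_gt0// subr_eq0; apply/eqP => xp.
  by apply: NZx; rewrite xp.
suff : dot (x - p) (z - p) <= 0.
  move=> h; rewrite -subr_gt0 -dotNr -dotDr.
  have -> : x - z = (x - p) - (z - p) by rewrite opprB addrA subrK.
  by rewrite [dot _ _]dotDr dotNr subr_gt0 (le_lt_trans h).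
rewrite leNgt; apply/negP => pos.
set a := dot _ _ in pos; set b := dot (z - p) (z - p).
have b0 : 0 <= b by exact: dot_ge0.
have ab : 0 < a + b by lra.
(* A step in [[0, 1]], also when [b = 0], with [t * b <= a]; hence [t * t * b] is less than the gain
   [2 * t * a]. *)
pose t := a / (a + b).
have t0 : 0 <= t by rewrite divr_ge0 ?ltW.
have t1 : t <= 1 by rewrite ler_pdivrMr// mul1r; lra.
have := pmin _ (mem_set (vZ _ _ _ Zz Zp t0 t1)).
rewrite -enormN -[leRHS]enormN !opprB enorm_le ?enorm_ge0// sqr_enorm.
have -> : x - (t *: z + (1 - t) *: p) = (x - p) - t *: (z - p).
  by apply/rowP => i; rewrite !mxE; ring.
rewrite dot_subZ -/a -/b.
have tE : t * (a + b) = a by rewrite mulfVK// gt_eqF.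
have t0' : 0 < t by rewrite divr_gt0.
have : t * b <= t * (a + b) by rewrite ler_pM2l//; lra.
nra.
Qed.

(** A point of the ball outside the zonotope could be separated from it, against the lower bound on
    [zsupp]. For the outer inclusion, test the support function in the direction [x] itself. *)
Lemma ball_zonotope (e : R) : 0 < e -> exists ws x0,
  (forall b, enorm b <= 1 -> zon ws [set 0] (b + x0)) /\
  (forall x, zon ws [set 0] (x + x0) -> enorm x <= 1 + e).
Proof.
move=> e0; have [ws h] := ball_approx_all e0.
exists [seq 2 *: w | w <- ws], (\sum_(w <- ws) w).
have bZ : convex_body (zon [seq 2 *: w | w <- ws] [set 0]).
  apply: body_zon; split; [by exists 0|exact: compact_set1|].
  by apply/convexP => x y t -> -> _ _; rewrite !scaler0 addr0.
split=> [b b1|x /zon_support[k ->]].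
  apply: contrapT => Nb; have [u hu] := closest_point bZ Nb.
  have [z zZ] := @zon_vertex ws [set 0] 0 u erefl.
  rewrite dot0r add0r dotDr dotNr => zE.
  have := hu _ zZ; have [+ _] := h u.
  rewrite dotDr; have := dot_le u b; have := enorm_ge0 u.
  by rewrite -zE; nra.
move=> /(_ x); rewrite addrK dot0r add0r -sqr_enorm.
have [_] := h x; have := enorm_ge0 x; nra.
Qed.

End ball_zonotope.

(** * Steiner's formula *)

Section steiner.
Variables (R : realType) (d : nat).
Implicit Types (K L : set 'rV[R]_d) (ws : seq 'rV[R]_d).

Lemma zon_msum ws K : zon ws K = msum K (zon ws [set 0]).
Proof.
elim: ws K => [|w ws IH] K /=.
  apply/predeqP => x; split => [Kx|[k Kk [_ -> <-]]]; last by rewrite addr0.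
  by exists x => //; exists 0; rewrite ?addr0.
have -> : msum [set 0] (seg w) = seg w.
  apply/predeqP => x; split => [[_ -> [y wy <-]]|wx]; first by rewrite add0r.
  by exists 0 => //; exists x; rewrite ?add0r.
by rewrite IH [in RHS]IH msumA.
Qed.

Lemma dil_zon r ws K : dil r (zon ws K) = zon [seq r *: w | w <- ws] (dil r K).
Proof.
have dilE L : dil r L = [set x *m r%:M | x in L].
  by apply: eq_imagel => x _; rewrite mul_mx_scalar.
elim: ws K => //= w ws IH K; rewrite IH; congr zon.
by rewrite !dilE image_msum_seg mul_mx_scalar.
Qed.

Lemma dil0 r : dil r [set 0] = [set (0 : 'rV[R]_d)].
Proof. by rewrite /dil image_set1 scaler0. Qed.

Lemma zon_dil r ws K : zon [seq r *: w | w <- ws] K = msum K (dil r (zon ws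
  [set 0])).
Proof. by rewrite dil_zon dil0 -zon_msum. Qed.

Lemma body_set1 (x : 'rV[R]_d) : convex_body [set x].
Proof.
split; [by exists x|exact: compact_set1|].
by apply/convexP => y z t -> -> _ _;
  rewrite -scalerDl [t + _]addrC subrK scale1r.
Qed.

Lemma le_rvol_shift K L (v : 'rV[R]_d) : compact K -> compact L ->
  (forall x, K x -> L (x + v)) -> rvol K <= rvol L.
Proof.
move=> cK cL KL; rewrite -lee_fin -!rvolE//.
rewrite -(vol_shift v (compact_vmeasurable cL)).
apply: le_vol KL; first exact: compact_vmeasurable.
by apply: vmeasurable_shift; exact: compact_vmeasurable.
Qed.

(* Up to a translation, [K + s L] is contained in [s (K + L)] for [s >= 1]. *)
Lemma rvol_msum_dil K L (s : R) : convex_body K -> convex_body L -> 1 <= s ->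
  rvol (msum K (dil s L)) <= s ^+ d * rvol (msum K L).
Proof.
move=> bK bL s1; have s0 : 0 < s by exact: lt_le_trans s1.
have bKL := body_msum bK bL.
have -> : s ^+ d * rvol (msum K L) = rvol (dil s (msum K L)).
  rewrite [RHS]/rvol vol_dil//; last by apply: compact_vmeasurable;
    exact: compact_body.
  by rewrite (rvolE (compact_body bKL)).
case: (bK) => -[k0 Kk0] _ /convexP vK.
(* The shift completes [k] to [s] times the convex combination of [k] and [k0] with weights [s^-1]
   and [1 - s^-1]. *)
apply: (@le_rvol_shift _ _ ((s - 1) *: k0)).
- by apply: compact_body; apply: body_msum => //; exact: body_dil.
- by apply: compact_body; exact: body_dil.
move=> _ [k Kk [_ [l Ll <-] <-]].
have t0 : 0 <= s^-1 by rewrite invr_ge0 ltW.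
have t1 : s^-1 <= 1 by rewrite invf_le1.
exists (s^-1 *: k + (1 - s^-1) *: k0 + l).
  by exists (s^-1 *: k + (1 - s^-1) *: k0); [exact: vK|exists l].
by apply/rowP => i; rewrite !mxE; field; rewrite gt_eqF.
Qed.

(** By [rvol_msum_dil] the volume of [K + r Z] grows at most like [r ^+ d], and all coefficients are
    nonnegative, so none of higher degree can be positive. *)
Lemma zcoef_degree ws k K : convex_body K -> (d < k)%N ->
  zcoef ws k (@rvol R d) K = 0.
Proof.
move=> bK dk; set c := zcoef _ _ _ _.
have affZ := segment_affine_zcoef ws _ (@segment_affine_rvol R d).
have c0 : 0 <= c by exact: saff_ge0 (affZ k) _ bK.
have [sk|ks] := ltnP (size ws) k; first by rewrite /c zcoef_size.
apply: le_anti; rewrite c0 andbT.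
have bZ : convex_body (zon ws [set 0]) by apply: body_zon; exact: body_set1.
set C := rvol (msum K (zon ws [set 0])).
have C0 : 0 <= C by exact: rvol_ge0.
have h r : 1 <= r -> r * c <= C.
  move=> r1; have r0 : 0 < r by exact: lt_le_trans r1.
  have rd : 0 < r ^+ d by rewrite exprn_gt0.
  rewrite -(ler_pM2l rd); apply: le_trans (rvol_msum_dil bK bZ r1).
  rewrite -zon_dil zon_expand ?(ltW r0)//; last exact: segment_affine_rvol.
  have ks' : (k < (size ws).+1)%N by [].
  rewrite (bigD1 (Ordinal ks'))//= -/c (@le_trans _ _ (r ^+ k * c))//.
    rewrite mulrA -exprSr ler_wpM2r// ler_weXn2l//.
  rewrite lerDl sumr_ge0// => j _; rewrite mulr_ge0 ?exprn_ge0 ?(ltW r0)//.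
  exact: saff_ge0 (affZ _) _ bK.
apply: (@le_slope _ c _ C) => s s0; rewrite mulr0 addr0.
by have := h (1 + s); rewrite lerDl mulrDl mul1r; apply.
Qed.

Definition pvol K r : R := rvol (parallel_body K r).

Lemma zonotope_seq_exists (m : nat) : exists p : seq 'rV[R]_d * 'rV[R]_d,
  (forall b, enorm b <= 1 -> zon p.1 [set 0] (b + p.2)) /\
  (forall x, zon p.1 [set 0] (x + p.2) -> enorm x <= 1 + m.+1%:R^-1).
Proof.
have [ws [x0 h]] := @ball_zonotope R d (m.+1%:R^-1) (ltac:(by rewrite
  invr_gt0)).
by exists (ws, x0).
Qed.

(** Generators of zonotopes tending to the unit ball. The centres are dropped, as volumes ignore
    translations. *)
Definition bzon m := (projT1 (cid (zonotope_seq_exists m))).1.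

(** Up to translation the zonotope contains the ball and lies in its dilate by [l]; [rvol_msum_dil]
    converts that dilation into the factor [l ^+ d]. *)
Lemma pvol_bzon m K r : convex_body K -> 0 <= r ->
  pvol K r <= rvol (zon [seq r *: w | w <- bzon m] K) <=
  (1 + m.+1%:R^-1) ^+ d * pvol K r.
Proof.
move=> bK r0; rewrite /bzon; case: cid => -[ws x0] /= [h1 h2].
rewrite zon_dil /pvol parallel_bodyE.
have bB := @convex_body_unit_ball R d.
have bZ : convex_body (zon ws [set 0]) by apply: body_zon; exact: body_set1.
set l := 1 + _; have l1 : 1 <= l by rewrite lerDl invr_ge0.
have l0 : 0 < l by exact: lt_le_trans l1.
have cKB s : compact (msum K (dil s (@unit_ball R d))).
  by apply: compact_body; apply: body_msum => //; exact: body_dil.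
have cKZ : compact (msum K (dil r (zon ws [set 0]))).
  by apply: compact_body; apply: body_msum => //; exact: body_dil.
apply/andP; split.
  apply: (@le_rvol_shift _ _ (r *: x0)) => //.
  move=> _ [k Kk [_ [b Bb <-] <-]]; exists k => //.
  exists (r *: (b + x0)); last by rewrite scalerDr addrA.
  by exists (b + x0) => //; exact: h1.
apply: le_trans (rvol_msum_dil bK (body_dil r bB) l1).
apply: (@le_rvol_shift _ _ (- (r *: x0))) => //.
  by apply: compact_body; apply: body_msum => //; do 2 apply: body_dil.
move=> _ [k Kk [_ [z Zz <-] <-]]; exists k => //.
exists (r *: (z - x0)); last by rewrite scalerBr addrA.
exists (r *: (l^-1 *: (z - x0))); last first.
  by rewrite !scalerA mulrAC mulfV ?gt_eqF// mul1r.
exists (l^-1 *: (z - x0)) => //.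
rewrite /unit_ball/= enormZ gtr0_norm ?invr_gt0// mulrC ler_pdivrMr// mul1r.
by apply: h2; rewrite subrK.
Qed.

(** * Interpolation and passage to the limit *)

Definition nodes : 'rV[R]_d.+1 := \row_j (j : nat)%:R.
Definition vdm : 'M[R]_d.+1 := Vandermonde d.+1 nodes.

Lemma vdm_unit : vdm \in unitmx.
Proof.
rewrite unitmxE det_Vandermonde unitfE; apply/prodf_neq0 => i _.
apply/prodf_neq0 => j ij; rewrite !mxE subr_eq0 eqr_nat.
by rewrite gtn_eqF.
Qed.

Lemma mul_vdm (q : 'rV[R]_d.+1) j :
  (q *m vdm) 0 j = \sum_(k < d.+1) (j : nat)%:R ^+ k * q 0 k.
Proof. by rewrite mxE; apply: eq_bigr => k _; rewrite !mxE mulrC. Qed.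

(* The coefficients of Steiner's polynomial, by interpolation at [0, ..., d]. *)
Definition steiner_coef K : 'rV[R]_d.+1 :=
  (\row_j pvol K (j : nat)%:R) *m invmx vdm.

(** The number of segments varies with [m]. Padding with zeros or discarding vanishing terms leaves
    [d + 1] coefficients for every [m]. *)
Lemma rvol_bzon m K r : convex_body K -> 0 <= r ->
  rvol (zon [seq r *: w | w <- bzon m] K) =
  \sum_(k < d.+1) r ^+ k * zcoef (bzon m) k (@rvol R d) K.
Proof.
move=> bK r0; rewrite zon_expand//; last exact: segment_affine_rvol.
pose F k := r ^+ k * zcoef (bzon m) k (@rvol R d) K.
have tail n1 n2 : (n1 <= n2)%N -> (forall k, (n1 <= k)%N -> F k = 0) ->
    \sum_(k < n2) F k = \sum_(k < n1) F k.
  move=> n12 F0; rewrite -!(big_mkord xpredT F) (big_cat_nat (leq0n n1) n12)/=.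
  rewrite [X in _ + X](_ : _ = 0) ?addr0// big_nat_cond big1// => k.
  by move=> /andP[/andP[/F0]].
have [sd|sd] := leqP (size (bzon m)) d.
  by rewrite -(tail _ d.+1) // => k sk; rewrite /F zcoef_size ?mulr0.
by rewrite (tail d.+1) ?(leqW sd)// => k dk; rewrite /F zcoef_degree ?mulr0.
Qed.

Lemma cvg_bzon K r : convex_body K -> 0 <= r ->
  rvol (zon [seq r *: w | w <- bzon m] K) @[m --> \oo] --> pvol K r.
Proof.
move=> bK r0.
apply: (@squeeze_cvgr _ _ _ _ (fun=> pvol K r)
  (fun m => (1 + m.+1%:R^-1) ^+ d * pvol K r)).
- by near=> m; exact: pvol_bzon.
- exact: cvg_cst.
rewrite -[X in _ --> X]mul1r; apply: cvgMl.
have c1 : 1 + m.+1%:R^-1 @[m --> \oo] --> (1 : R).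
  rewrite -[X in _ --> X]addr0; apply: cvgD; first exact: cvg_cst.
  exact: cvg_harmonic.
have := continuous_cvg _ (@exprn_continuous R d 1) c1.
by rewrite expr1n; apply.
Unshelve. all: end_near. Qed.

Lemma cvg_sumr (I : finType) (f : I -> R^nat) (a : I -> R) :
  (forall i, f i m @[m --> \oo] --> a i) ->
  \sum_i f i m @[m --> \oo] --> \sum_i a i.
Proof. by move=> h; apply: cvg_big => //; exact: add_continuous. Qed.

(** The coefficients are fixed linear combinations, through the inverse Vandermonde matrix, of the
    volumes at the nodes, which converge. *)
Lemma cvg_zcoef K k : convex_body K ->
  zcoef (bzon m) (k : 'I_d.+1) (@rvol R d) K @[m --> \oo] -->
    steiner_coef K 0 k.
Proof.
move=> bK.
pose q m : 'rV[R]_d.+1 := \row_k zcoef (bzon m) k (@rvol R d) K.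
pose p m : 'rV[R]_d.+1 :=
  \row_j rvol (zon [seq (j : nat)%:R *: w | w <- bzon m] K).
have qp m : q m *m vdm = p m.
  apply/rowP => j; rewrite mul_vdm mxE rvol_bzon//.
  by apply: eq_bigr => i _; rewrite mxE.
rewrite (_ : (fun m => _) = fun m => \sum_j p m 0 j * invmx vdm j k);
  last first.
  apply/funext => m; transitivity ((p m *m invmx vdm) 0 k); last by rewrite mxE.
  by rewrite -qp mulmxK ?vdm_unit// mxE.
rewrite mxE; apply: cvg_sumr => j; rewrite mxE; apply: cvgMl.
by under eq_cvg do rewrite mxE; exact: cvg_bzon.
Qed.

(** Both sides are limits of the two sides of [rvol_bzon]. *)
Lemma pvol_polynomial K r : convex_body K -> 0 <= r ->
  pvol K r = \sum_(k < d.+1) r ^+ k * steiner_coef K 0 k.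
Proof.
move=> bK r0; have g := cvg_bzon bK r0.
rewrite (funext (fun m => rvol_bzon m bK r0)) in g.
have h : \sum_(k < d.+1) r ^+ k * zcoef (bzon m) k (@rvol R d) K @[m --> \oo]
    --> \sum_(k < d.+1) r ^+ k * steiner_coef K 0 k.
  by apply: cvg_sumr => k; apply: cvgMr; exact: cvg_zcoef.
exact: cvg_unique g h.
Qed.

End steiner.

(** * Contractions *)

Section contraction.
Variables (R : realType) (d : nat).
Implicit Types (K : set 'rV[R]_d) (M : 'M[R]_d).

Lemma steiner_coef_shadow_convex (L : set 'rV[R]_(1 + d)) y y' t k :
  let F y := steiner_coef [set u *m proj_mx y | u in L] 0 k in
  convex_body L -> 0 <= t -> t <= 1 ->
  F (t *: y + (1 - t) *: y') <= t * F y + (1 - t) * F y'.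
Proof.
move=> F bL t0 t1.
have c z := @cvg_zcoef R d _ k (body_mulmx (proj_mx z) bL).
apply: (ler_cvg_to (c _) (cvgD (cvgMr (c y)) (cvgMr (c y')))).
by near=> m; exact: zcoef_shadow_convex.
Unshelve. all: end_near. Qed.

(** Lifting [K] to the points [(x v^T, x M)] makes all the images under [M + s *: (v^T *m u)]
    shadows of one body, along directions affine in [s]; [s = 0] lies between [s1] and [s2]. *)
Lemma steiner_coef_rank_one M (u v : 'rV[R]_d) (s1 s2 c : R) k K :
  convex_body K -> s1 < 0 -> 0 < s2 ->
  steiner_coef [set x *m (M + s1 *: (v^T *m u)) | x in K] 0 k <= c ->
  steiner_coef [set x *m (M + s2 *: (v^T *m u)) | x in K] 0 k <= c ->
  steiner_coef [set x *m M | x in K] 0 k <= c.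
Proof.
move=> bK s10 s20 h1 h2.
pose L : set 'rV[R]_(1 + d) := [set x *m row_mx v^T M | x in K].
have bL : convex_body L by exact: body_mulmx.
have LE s : [set z *m proj_mx (- (s *: u)) | z in L] =
    [set x *m (M + s *: (v^T *m u)) | x in K].
  rewrite /L image_comp; apply: eq_imagel => x _ /=.
  rewrite mul_mx_row mul_row_col mulmx1 opprK mulmxDr addrC; congr (_ + _).
  by rewrite -!scalemxAr mulmxA.
have s12 : 0 < s2 - s1 by lra.
pose t := s2 / (s2 - s1).
have t0 : 0 <= t by rewrite divr_ge0 ?ltW.
have t1 : t <= 1 by rewrite ler_pdivrMr// mul1r; lra.
have tE : t * s1 + (1 - t) * s2 = 0 by rewrite /t; field; rewrite gt_eqF.
have := steiner_coef_shadow_convex (- (s1 *: u)) (- (s2 *: u)) k bL t0 t1.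
have -> : t *: - (s1 *: u) + (1 - t) *: - (s2 *: u) = - (0 *: u).
  by rewrite -tE; apply/rowP => l; rewrite !mxE; ring.
rewrite !LE scale0r addr0; nra.
Qed.

(** An orthogonal map carries the parallel bodies of [K] to those of its image, so the interpolated
    volumes agree. *)
Lemma steiner_coef_orth M K k : M *m M^T = 1%:M -> convex_body K ->
  steiner_coef [set x *m M | x in K] 0 k = steiner_coef K 0 k.
Proof.
move=> MM bK; congr ((_ *m _) 0 k); apply/rowP => j; rewrite !mxE.
rewrite /pvol /rvol; congr fine.
rewrite -[RHS](vol_orth MM); last first.
  by apply: compact_vmeasurable; apply: compact_body; exact: body_parallel.
have MM' : M^T *m M = 1%:M by exact: mulmx1C.
congr vol; apply/predeqP => z; split.
  move=> [_ [x Kx <-] [b Bb <-]].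
  exists (x + (j : nat)%:R *: (b *m M^T)).
    exists x => //; exists (b *m M^T) => //.
    by rewrite /unit_ball/= enormE dot_mull trmxK -mulmxA MM' mulmx1 -enormE.
  by rewrite mulmxDl -scalemxAl -mulmxA MM' mulmx1.
move=> [_ [x Kx [b Bb <-]] <-]; exists (x *m M); first by exists x.
exists (b *m M); last by rewrite mulmxDl scalemxAl.
by rewrite /unit_ball/= enorm_orth.
Qed.

(** * The defect from orthogonality *)

Definition defect M : 'M[R]_d := 1%:M - M *m M^T.

(** With [y = x] this shows that [M] is a contraction exactly when [defect M] is positive
    semidefinite. *)
Lemma dot_defect M (x y : 'rV[R]_d) :
  dot (x *m defect M) y = dot x y - dot (x *m M) (y *m M).
Proof. by rewrite mulmxBr mulmx1 dotDl dotNl mulmxA (dot_mull _ M^T) trmxK. Qed.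

Lemma dot_defectC M (x y : 'rV[R]_d) :
  dot (x *m defect M) y = dot (y *m defect M) x.
Proof. by rewrite !dot_defect (dotC x) (dotC (x *m M)). Qed.

(** In a positive semidefinite matrix, a zero diagonal entry forces its whole row to vanish. *)
Lemma defect_pivot M i : (forall x, dot (x *m M) (x *m M) <= dot x x) ->
  row i (defect M) != 0 -> 0 < defect M i i.
Proof.
move=> cM; set A := defect M => Ai0.
have ge0 x : 0 <= dot (x *m A) x by rewrite dot_defect subr_ge0.
pose e : 'rV[R]_d := delta_mx 0 i.
have eA : e *m A = row i A by rewrite rowE.
have AiiE : A i i = dot (e *m A) e by rewrite dot_delta eA [RHS]mxE.
rewrite lt_neqAle AiiE ge0 andbT; apply/eqP => a0.
have /eqP[] := Ai0; apply: dot_eq0; rewrite -eA.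
set v := e *m A; apply/eqP; rewrite eq_sym; apply/negPn/negP => q0.
set q := dot v v in q0; pose p := dot (v *m A) v.
(* If the pivot were 0, the quadratic form at [v + t *: e] would be [p + 2 * t * q], which is -1 for
   this [t]. *)
pose t := - (p + 1) / (2 * q).
have := ge0 (v + t *: e).
rewrite mulmxDl -scalemxAl !(dotDl, dotDr, dotZl,
  dotZr) -a0 (dot_defectC M v e).
rewrite -/A -/v -/q -/p.
have : t * q = - (p + 1) / 2 by rewrite /t; field; rewrite eq_sym.
move=> tq; lra.
Qed.

(** If [M] is singular, [u] is a kernel vector and [b = 0]; otherwise [u] is the preimage of [v]. *)
Lemma exists_aligned M (v : 'rV[R]_d) : v != 0 ->
  exists (u : 'rV[R]_d) (b : R), u != 0 /\ u *m M^T = b *: v.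
Proof.
move=> v0; have [/det0P[u u0 uM]|dM] := boolP (\det M^T == 0).
  by exists u, 0; rewrite scale0r.
have uM : M^T \in unitmx by rewrite unitmxE unitfE.
exists (v *m invmx M^T), 1; split; last by rewrite mulmxKV ?scale1r.
apply/negP => /eqP v'0; move/eqP: v0; apply.
by rewrite -[v](mulmxKV uM) v'0 mul0mx.
Qed.

(** The alignment of [u *m M^T] with [v] makes the cross terms multiples of [v^T *m v] as well. *)
Lemma defect_rank_one M (u v : 'rV[R]_d) (b s : R) : u *m M^T = b *: v ->
  defect (M + s *: (v^T *m u)) =
  defect M - (2 * s * b + s ^+ 2 * dot u u) *: (v^T *m v).
Proof.
move=> uM; have Mu : M *m u^T = b *: v^T.
  by rewrite -[LHS]trmxK trmx_mul trmxK uM linearZ.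
have E : (M + s *: (v^T *m u)) *m (M + s *: (v^T *m u))^T =
    M *m M^T + (2 * s * b + s ^+ 2 * dot u u) *: (v^T *m v).
  rewrite [(_ + _)^T]linearD/= linearZ/= trmx_mul trmxK.
  rewrite mulmxDl !mulmxDr -!scalemxAl -!scalemxAr -!mulmxA uM !(mulmxA M) Mu.
  rewrite (mulmxA u) [u *m u^T]mx11_scalar -dotE mul_scalar_mx.
  rewrite -!scalemxAl -!scalemxAr !scalerA -!addrA -!scalerDl;
    congr (_ + _ *: _).
  by rewrite expr2; ring.
by rewrite /defect E opprD addrA.
Qed.

(** Induction on the number of nonzero rows of [defect M]; when none is left, [M] is orthogonal. *)
Lemma steiner_coef_contraction M K k :
  (forall x, dot (x *m M) (x *m M) <= dot x x) -> convex_body K ->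
  steiner_coef [set x *m M | x in K] 0 k <= steiner_coef K 0 k.
Proof.
pose supp M : {set 'I_d} := finset (fun i => row i (defect M) != 0).
move=> + bK; have [n] := ubnP #|supp M|; elim: n M => // n IH M.
rewrite ltnS => sn cM.
have [s0|[i]] := set_0Vmem (supp M).
  rewrite steiner_coef_orth//; apply/esym/eqP; rewrite -subr_eq0.
  apply/eqP/row_matrixP => i; rewrite row0.
  apply/eqP/negPn/negP => h; have : i \in supp M by rewrite inE.
  by rewrite s0 finset.in_set0.
rewrite inE => i0; pose v := row i (defect M).
have a0 := defect_pivot cM i0; set a := defect M i i in a0.
have [u [b [u0 uM]]] := exists_aligned M i0.
pose g := dot u u; have g0 : 0 < g by rewrite /g -sqr_enorm exprn_gt0//
  enorm_gt0.
(* The equation [2 * s * b + s ^+ 2 * g = a^-1] has the roots [(- b - D) / g] and [(- b + D) / g],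
   of opposite signs because [b] is smaller than [D] in absolute value. *)
pose D := Num.sqrt (b ^+ 2 + g / a).
have ga0 : 0 < g / a by rewrite divr_gt0.
have D2 : D ^+ 2 = b ^+ 2 + g / a.
  by rewrite sqr_sqrtr// addr_ge0 ?sqr_ge0 ?ltW.
have D0 : 0 <= D by exact: sqrtr_ge0.
have bD : `|b| < D.
  by rewrite -(@ltr_pXn2r _ 2)// ?nnegrE// D2 real_normK ?num_real// ltrDl.
have step s : 2 * s * b + s ^+ 2 * g = a^-1 ->
    steiner_coef [set x *m (M + s *: (v^T *m u)) | x in K] 0 k <= steiner_coef
      K 0 k.
  move=> sE.
  have dE : defect (M + s *: (v^T *m u)) = defect M - a^-1 *: (v^T *m v).
    by rewrite (defect_rank_one s uM) -/g sE.
  have eA : delta_mx 0 i *m defect M = v by rewrite -rowE.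
  have vi : v 0 i = a by rewrite mxE.
  have symA j : v 0 j = defect M j i.
    by rewrite mxE /defect !mxE eq_sym; congr (_ - _); apply: eq_bigr => l _;
      rewrite !mxE mulrC.
  have rowE' j : row j (defect (M + s *: (v^T *m u))) =
      row j (defect M) - (a^-1 * v 0 j) *: v.
    by apply/rowP => l; rewrite dE !mxE big_ord1 !mxE mulrA.
  apply: IH.
    (* A zero row [j] has [v 0 j = 0] by symmetry and stays zero, while row [i] becomes zero. *)
    apply: leq_trans sn; apply: proper_card; apply/properP; split.
      apply/fintype.subsetP => j; rewrite !inE; apply: contra => /eqP j0.
      have vj : v 0 j = 0 by rewrite symA; have /rowP/(_ i) := j0; rewrite !mxE.
      by rewrite rowE' j0 vj mulr0 scale0r subr0.
    exists i; rewrite inE// negbK rowE' vi mulVf ?gt_eqF// scale1r.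
    by rewrite subrr.
  move=> x; rewrite -subr_ge0 -dot_defect dE mulmxBr dotDl dotNl -scalemxAr
    dotZl.
  rewrite mulmxA [x *m v^T]mx11_scalar -dotE mul_scalar_mx dotZl.
  set q := dot x v; rewrite (dotC v) -/q.
  (* Completing the square: the new quadratic form at [x] is the old one at [y], hence
     nonnegative. *)
  pose y := x - (a^-1 * q) *: delta_mx 0 i.
  have yA : y *m defect M = x *m defect M - (a^-1 * q) *: v.
    by rewrite mulmxBl -scalemxAl eA.
  have := cM y; rewrite -subr_ge0 -dot_defect yA /y.
  rewrite !(dotDl, dotDr, dotNl, dotNr, dotZl, dotZr).
  rewrite (dot_defectC M x) eA (dotC v x) -/q.
  rewrite dot_delta vi.
  have : a^-1 * a = 1 by rewrite mulVf// gt_eqF.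
  move=> aa; congr (0 <= _); rewrite -[a in _ * a]mulr1; field.
  by rewrite gt_eqF.
have gn0 : g != 0 by rewrite gt_eqF.
have an0 : a != 0 by rewrite gt_eqF.
move: bD; rewrite ltr_norml => /andP[bD1 bD2].
apply: (@steiner_coef_rank_one M u v ((- b - D) / g) ((- b + D) / g)) => //.
- by rewrite pmulr_llt0 ?invr_gt0//; lra.
- by rewrite divr_gt0//; lra.
- apply: step.
  have -> : 2 * ((- b - D) / g) * b + ((- b - D) / g) ^+ 2 * g = (D ^+ 2 - b ^+
    2) / g.
    by field.
  by rewrite D2; field; rewrite an0.
- apply: step.
  have -> : 2 * ((- b + D) / g) * b + ((- b + D) / g) ^+ 2 * g = (D ^+ 2 - b ^+
    2) / g.
    by field.
  by rewrite D2; field; rewrite an0.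
Qed.

(** * From polynomial coefficients to intrinsic volumes *)

Lemma kappa_gt0 j : 0 < kappa R j.
Proof. exact: rvol_unit_ball_gt0. Qed.

Lemma volume_parallel_body K r : convex_body K -> 0 <= r ->
  vol (parallel_body K r) =
  (\sum_(i < d.+1) r ^+ (d - i) * steiner_coef K 0 (rev_ord i))%:E.
Proof.
move=> bK r0; rewrite rvolE; last by apply: compact_body; exact: body_parallel.
rewrite -/(pvol K r) pvol_polynomial// (reindex_inj rev_ord_inj)/=.
by congr EFin; apply: eq_bigr => i _; rewrite subSS.
Qed.

(** The right-hand side solves Steiner's formula, so [get] returns a genuine solution; evaluation at
    the nodes and invertibility of the Vandermonde matrix identify the two. The index is reversed
    because [V i] goes with [r ^+ (d - i)]. *)
Lemma intrinsic_volumeE K i : convex_body K ->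
  intrinsic_volume K i = steiner_coef K 0 (rev_ord i) / kappa R (d - i).
Proof.
move=> bK; set V := intrinsic_volume K.
have kn0 j : kappa R j != 0 by rewrite gt_eqF// kappa_gt0.
have VP : steiner_formula K V.
  apply: getPex.
  exists (fun i => steiner_coef K 0 (rev_ord i) / kappa R (d - i)) => r r0.
  rewrite volume_parallel_body//; congr EFin; apply: eq_bigr => j _.
  by rewrite -[RHS]mulrA [X in _ = _ * X]mulrCA mulfV ?mulr1.
pose q : 'rV[R]_d.+1 := \row_k (kappa R k * V (rev_ord k)).
have : q *m vdm R d = steiner_coef K *m vdm R d.
  apply/rowP => j; rewrite !mul_vdm -pvol_polynomial// /pvol /rvol VP//=.
  rewrite [RHS](reindex_inj rev_ord_inj)/=; apply: eq_bigr => k _.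
  by rewrite mxE mulrA subSS subKn// -ltnS.
move=> /(congr1 (mulmx^~ (invmx (vdm R d)))); rewrite !mulmxK ?vdm_unit// => <-.
by rewrite mxE rev_ordK /= subSS mulrAC mulfV ?mul1r.
Qed.

End contraction.

Theorem corollary2p8 (R : realType) (d : nat) (K : set 'rV[R]_d)
    (T : {linear 'rV[R]_d -> 'rV[R]_d}) :
  convex_body K -> euclidean_contraction T ->
  forall i : 'I_d.+1, intrinsic_volume (T @` K) i <= intrinsic_volume K i.
Proof.
move=> bK cT i.
have TE : T @` K = [set x *m lin1_mx T | x in K].
  by apply: eq_imagel => x _; rewrite mul_rV_lin1.
rewrite TE !intrinsic_volumeE//; last exact: body_mulmx.
rewrite ler_pM2r ?invr_gt0 ?kappa_gt0//.
apply: steiner_coef_contraction => // x.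
have := cT x 0; rewrite linear0 !subr0 mul_rV_lin1.
by rewrite enorm_le ?enorm_ge0// sqr_enorm.
Qed.
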